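(* Let $p\in(0,1)$ and $(s,t)\in\mathbb R_+^2$. Then for all $\xi\in\mathbb R$, the convex dual $J^*_{s,t}(\xi)=\sup_{r\in\mathbb R}\{r\xi-J_{s,t}(r)\}$ is given by $$J^*_{s,t}(\xi)=\begin{cases}\displaystyle\inf_{u\in(p,1]}\Big\{s\,C_{\mathcal B}^{(u)}(\xi)-t\,C_{\mathcal G}^{\left(\frac{u-p}{u(1-p)}\right)}(-\xi)\Big\}, & \text{if }\xi>0,\\ 0, & \text{if }\xi=0,\\ \infty, & \text{if }\xi<0.\end{cases}$$
   Context: Here $\mathbb R_+=[0,\infty)$ and $\mathbb Z_+=\{0,1,2,\dots\}$. Let $\{\omega_v\}_{v\in\mathbb Z_+^2}$ be i.i.d. Bernoulli($p$) random variables with values in $\{0,1\}$ and $\mathbb P\{\omega_v=1\}=p$. An admissible path from $v$ to $w$ is a sequence $v=v_0,\dots,v_k=w$ in $\mathbb Z_+^2$ with $v_{i+1}-v_i\in\{e_1,e_2\}$. The last passage time is $G_{v,w}=\max_{\pi}\sum_{i}\omega_{v_{i+1}}\mathbf 1\{v_{i+1}-v_i=e_1\}$ (maximum over admissible paths from $v$ to $w$), and $G_{m,n}=G_{(0,0),(m,n)}$. Right-tail rate function: for $s,t>0$ and $r<s$, $J_{s,t}(r)=-\lim_{N\to\infty}N^{-1}\log\mathbb P\{G_{\lfloor Ns\rfloor,\lfloor Nt\rfloor}\ge Nr\}$ (the limit exists and equals $0$ for $r\le 0$). As a function of $(s,t,r)$ it is extended continuously to $\{s,t\ge0,\ r\le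 s\}$ and set equal to $+\infty$ elsewhere, so that it is a lower semicontinuous convex function on $\mathbb R^3$. Log-moment generating functions: $C_{\mathcal B}^{(u)}(\xi)=\log(1-u+ue^{\xi})$ for $\xi\in\mathbb R$ (Bernoulli); $C_{\mathcal G}^{(q)}(\xi)=\log\frac{q}{1-(1-q)e^{\xi}}$ for $\xi<-\log(1-q)$ and $C_{\mathcal G}^{(q)}(\xi)=\infty$ otherwise (geometric on $\mathbb Z_+$; $C^{(1)}_{\mathcal G}\equiv0$). *)

(* Defs.v *)
From HB Require Import structures.
From mathcomp Require Import all_boot all_order all_algebra.
From mathcomp Require Import all_classical all_reals all_analysis.

Set Implicit Arguments.
Unset Strict Implicit.
Unset Printing Implicit Defensive.

Import Order.TTheory GRing.Theory Num.Theory.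
Import numFieldNormedType.Exports.

Local Open Scope classical_set_scope.
Local Open Scope ring_scope.

Definition site : Type := (nat * nat)%type.

Definition e1_shift (v : site) : site := (v.1.+1, v.2).
Definition e2_shift (v : site) : site := (v.1, v.2.+1).

Definition up_right (v w : site) : bool :=
  (w == e1_shift v) || (w == e2_shift v).

(* The path v = v_0, ..., v_k = w is represented by its start v together with
   q = [:: v_1; ...; v_k], as for [path] in MathComp. *)
Definition admissible (v w : site) (q : seq site) : bool :=
  path up_right v q && (last v q == w).

Fixpoint paths_of_length (k : nat) (v : site) : seq (seq site) :=
  if k is k'.+1 then
    map (cons (e1_shift v)) (paths_of_length k' (e1_shift v)) ++
    map (cons (e2_shift v)) (paths_of_length k' (e2_shift v))
  else [:: [::]].

(* A duplicate-free enumeration is not needed since it only indexes a maximum;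
   [mem_paths] shows that it consists of exactly the admissible paths. *)
Definition paths (v w : site) : seq (seq site) :=
  [seq q <- paths_of_length ((w.1 + w.2) - (v.1 + v.2)) v | last v q == w].

Lemma mem_paths_of_length (k : nat) (v : site) (q : seq site) :
  (q \in paths_of_length k v) = path up_right v q && (size q == k).
Proof.
elim: k v q => [|k IHk] v [|w q] /=.
- by [].
- by rewrite in_cons in_nil andbF.
- rewrite mem_cat; apply/negP => /orP[] /mapP[? _]; by [].
- rewrite mem_cat eqSS /up_right.
  have cons_map (z : site) :
    (w :: q \in map (cons z) (paths_of_length k z)) =
    (w == z) && (path up_right w q && (size q == k)).
    apply/mapP/andP => [[q' q'P [-> ->]]|[/eqP -> qP]].
      by rewrite -IHk eqxx.
    by exists q => //; rewrite IHk.
  by rewrite !cons_map -!andb_orl -andbA.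
Qed.

Lemma size_admissible (v w : site) (q : seq site) :
  admissible v w q -> (size q = (w.1 + w.2) - (v.1 + v.2))%N.
Proof.
move=> /andP[pq /eqP lq].
suff: (w.1 + w.2 = size q + (v.1 + v.2))%N by move=> ->; rewrite addnK.
rewrite -lq {w lq}; elim: q v pq => [//|z q IHq] v /= /andP[vz /IHq ->].
by case/orP: vz => /eqP -> /=; rewrite ?addSn ?addnS // addSn.
Qed.

Lemma mem_paths (v w : site) (q : seq site) :
  (q \in paths v w) = admissible v w q.
Proof.
rewrite mem_filter mem_paths_of_length /admissible.
apply/andP/andP => [[-> /andP[-> _]]//|[pq lq]].
split=> //; rewrite pq /=; apply/eqP/size_admissible.
by rewrite /admissible pq.
Qed.

(* Sum of omega at the end points of the e1-steps. *)
Definition path_weight (omega : site -> bool) (v : site) (q : seq site) : nat :=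
  (\sum_(e <- zip (v :: q) q | e.2 == e1_shift e.1) omega e.2)%N.

Definition last_passage (omega : site -> bool) (v w : site) : nat :=
  (\max_(q <- paths v w) path_weight omega v q)%N.

Section Randomness.
Context (d : measure_display) (T : measurableType d) (R : realType).
Variable P : probability T R.

Definition mutually_independent (I : eqType) (d' : measure_display)
    (T' : measurableType d') (X : I -> {RV P >-> T'}) : Prop :=
  forall (s : seq I) (B : I -> set T'), uniq s ->
    (forall i, i \in s -> measurable (B i)) ->
    P (\bigcap_(i in [set` s]) (X i @^-1` B i)) =
    (\prod_(i <- s) P (X i @^-1` B i))%E.

Definition iid_bernoulli (I : eqType) (p : R) (X : I -> {RV P >-> bool}) :
    Prop :=
  (forall i, P (X i @^-1` [set true]) = p%:E) /\ mutually_independent X.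

Variable omega : site -> {RV P >-> bool}.

Definition G (m n : nat) (x : T) : nat :=
  last_passage (fun v => omega v x) (0, 0)%N (m, n).

(* For nonnegative reals Num.truncn is the floor. *)
Definition log_tail (s t r : R) (N : nat) : \bar R :=
  (N%:R^-1%:E *
   lne (P [set x |
     (N%:R * r <= (G (Num.truncn (N%:R * s)) (Num.truncn (N%:R * t)) x)%:R)%R]))%E.

Definition J_interior (a : R * R * R) : \bar R :=
  let: (s, t, r) := a in (- lim (log_tail s t r N @[N --> \oo]))%E.

Definition interior_domain : set (R * R * R) :=
  [set a | let: (s, t, r) := a in [/\ 0 < s, 0 < t & r < s]].

(* At boundary points of the closed cone the value of the continuous extension
   is the limit of the values at points of the open cone. *)
Definition J (s t r : R) : \bar R :=
  if [&& 0 < s, 0 < t & r < s] then J_interior (s, t, r)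
  else if [&& 0 <= s, 0 <= t & r <= s] then
    lim (J_interior a @[a --> within interior_domain (nbhs (s, t, r))])
  else +oo%E.

End Randomness.

Definition convex_dual (R : realType) (f : R -> \bar R) (xi : R) : \bar R :=
  ereal_sup [set ((r * xi)%:E - f r)%E | r in [set: R]].

Definition C_bernoulli (R : realType) (u xi : R) : R :=
  ln (1 - u + u * expR xi).

(* The case q = 1 is separate because -log 0 = +oo while ln 0 = 0 here. *)
Definition C_geometric (R : realType) (q xi : R) : \bar R :=
  if q == 1 then 0%E
  else if xi < - ln (1 - q) then (ln (q / (1 - (1 - q) * expR xi)))%:E
  else +oo%E.

(* Main.v *)
Require Import Defs.
From HB Require Import structures.
From mathcomp Require Import all_boot all_order all_algebra.
From mathcomp Require Import all_classical all_reals all_analysis.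
From mathcomp Require Import zify ring lra.

(** Let [x = expR xi] with [xi > 0], and let Z(m, n), the function [mgf]
    below, be the expectation of [x ^+ G(m, n)].

    Tail probabilities of last passage values are supermultiplicative.  Hence the
    rate J(s, t, r) exists and P(G >= N r) <= exp(- N J(s, t, r)) for every N, not
    only asymptotically.  Together with the exponential Markov inequality this
    identifies the dual of J(s, t, .) with the exponential growth rate of
    Z(N s, N t), so that the task is to find this growth rate.

    Put independent Bernoulli(u) increments along the bottom and geometric(q)
    increments along the left side, with q = (u - p) / (u (1 - p)).  This choice
    of q makes the product law invariant under a corner step ([burke_local]), so
    the increments along the top of any number of rows are again independent
    Bernoulli(u) variables ([burke]).  Their sum is the last passage value with
    boundary minus the sum of the left increments.  Write B(u) for the logarithmic
    generating function of a Bernoulli(u) variable at xi, and - D(u) for that of a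
    geometric(q) variable at - xi.  Two bounds follow.
    - The boundary can only help, so Z(m, n) <= exp (m B(u) + (n + 1) D(u)) for
      every u in (p, 1] ([mgf_le_stationary]).  This is one half of the formula.
    - An optimal path leaves the boundary somewhere, so exp (m B(u)) is at most a
      sum over exit points of an explicit boundary factor times a bulk factor
      Z(m - k, n) or Z(m, n - l) ([stationary_le_mgf]).

    The second bound is inverted as follows ([tangent_lower_bound]).  Suppose that
    u is a stationary point of s B + t D.  For an exit point at a macroscopic
    distance from the corner, the bulk factor belongs to another direction, for
    which u is not stationary; a slight change of u in the first bound shows that
    this exit point contributes exponentially less than exp (m B(u)).  Only exits
    near the corner remain, and there the bulk factor is at most Z(m, n).  Hence
    Z(N s, N t) grows at least like exp (N (s B(u) + t D(u))).

    Stationarity is a quadratic equation in u, with a root in (p, 1) if and only if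
    0 < t / s < (1 - p) / p.  For larger slopes monotonicity in t gives the value at
    u = 1, and for t = 0 the value is the limit as u tends to p
    ([dual_lower_bound]).

    On the boundary of the domain J is a limit.  Monotonicity, subadditivity and
    homogeneity of the rate show that it is the supremum of the interior rates at
    points with larger t and smaller r ([J_interior_cvg]), and this passes both
    halves of the argument to the boundary ([J_bracket]).  For xi <= 0 the formula
    only reflects that J is nonnegative and vanishes for r <= 0. *)

Import Order.TTheory GRing.Theory Num.Theory.
Import numFieldNormedType.Exports.

Local Open Scope classical_set_scope.
Local Open Scope ring_scope.

Set Implicit Arguments.
Unset Strict Implicit.


(** * Last passage values by recursion *)

(** [c i j] is the weight of the horizontal step from column [i] to column
    [i.+1] in row [j].  Only these steps carry weight, so a last passage value
    obeys a recursion on its last step, and all that is used of the maximum over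
    paths below is this recursion. *)
Fixpoint lpp (c : nat -> nat -> bool) (m n : nat) : nat :=
  if m is i.+1 then
    (fix lpp_row (n : nat) : nat :=
       if n is j.+1 then maxn (lpp c i n + c i n) (lpp_row j)
       else (lpp c i 0 + c i 0)%N) n
  else 0%N.

Definition shift (a b : nat) (c : nat -> nat -> bool) : nat -> nat -> bool :=
  fun i j => c (a + i)%N (b + j)%N.

Lemma lppS0 c i : lpp c i.+1 0 = (lpp c i 0 + c i 0%N)%N.
Proof. by []. Qed.

Lemma lppSS c i j :
  lpp c i.+1 j.+1 = maxn (lpp c i j.+1 + c i j.+1) (lpp c i.+1 j).
Proof. by []. Qed.

Lemma lpp_leS c m n : (lpp c m n <= lpp c m n.+1)%N.
Proof. by case: m => [//|m]; rewrite lppSS leq_maxr. Qed.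

Lemma lpp_step c m n : (lpp c m n + c m n <= lpp c m.+1 n)%N.
Proof. by case: n => [|n]; rewrite ?lppSS ?leq_maxl. Qed.

Lemma lpp_mono c m m' n n' :
  (m <= m')%N -> (n <= n')%N -> (lpp c m n <= lpp c m' n')%N.
Proof.
move=> mm' nn'; apply: (@leq_trans (lpp c m' n)).
  elim: m' mm' => [|m' IH]; first by rewrite leqn0 => /eqP ->.
  rewrite leq_eqVlt => /orP[/eqP -> //|/IH {}IH].
  by apply: (leq_trans IH); apply: leq_trans (lpp_step c m' n); apply: leq_addr.
elim: n' nn' => [|n' IH]; first by rewrite leqn0 => /eqP ->.
rewrite leq_eqVlt => /orP[/eqP -> //|/IH {}IH].
exact: leq_trans IH (lpp_leS _ _ _).
Qed.

Lemma lpp_le c m n : (lpp c m n <= m)%N.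
Proof.
elim: m n => [//|m IHm]; elim=> [|n IHn].
  by rewrite lppS0; have := IHm 0%N; case: (c m 0%N) => /=; lia.
rewrite lppSS geq_max IHn andbT.
by have := IHm n.+1; case: (c m n.+1) => /=; lia.
Qed.

Lemma eq_lpp c c' m n :
  (forall i j, (i < m)%N -> (j <= n)%N -> c i j = c' i j) ->
  lpp c m n = lpp c' m n.
Proof.
elim: m n => [//|m IHm]; elim=> [|n IHn] h.
  rewrite !lppS0 h// (IHm 0%N)// => i j im jn; apply: h => //.
  exact: ltnW.
rewrite !lppSS IHn; last first.
  by move=> i j im jn; apply: h => //; apply: leqW.
rewrite h// (IHm n.+1)// => i j im jn; apply: h => //; exact: ltnW.
Qed.

(** Concatenating an optimal path to [(a, b)] with an optimal path from there is
    one way to reach [(a + m, b + n)]. *)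
Lemma lpp_superadd c a b m n :
  (lpp c a b + lpp (shift a b c) m n <= lpp c (a + m) (b + n))%N.
Proof.
elim: m n => [|m IHm] n.
  by rewrite /= addn0 addn0; apply: lpp_mono; rewrite ?leq_addr.
elim: n => [|n IHn].
  rewrite lppS0 addnA addnS.
  apply: leq_trans (lpp_step _ _ _); rewrite leq_add//.
rewrite lppSS addn_maxr geq_max; apply/andP; split.
  rewrite addnA addnS.
  apply: leq_trans (lpp_step _ _ _); rewrite leq_add//.
by apply: (leq_trans IHn); apply: lpp_mono => //; rewrite leq_add2l.
Qed.

Lemma lpp_row_full c m n :
  (forall i, (i < m)%N -> c i 0%N = true) -> (m <= lpp c m n)%N.
Proof.
move=> h; apply: (@leq_trans (lpp c m 0)); last exact: lpp_mono.
elim: m h => [//|m IH] h; rewrite lppS0 h// addn1 ltnS; apply: IH => i im.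
by apply: h; apply: ltnW.
Qed.

Lemma path_weight_rcons (w : site -> bool) v q z :
  path_weight w v (rcons q z) =
  (path_weight w v q + (z == e1_shift (last v q)) * w z)%N.
Proof.
rewrite /path_weight; elim: q v => [|a q IH] v /=.
  by rewrite big_cons !big_nil/=; case: eqP => _; rewrite ?addn0 ?mul1n ?mul0n ?add0n.
by rewrite !big_cons/= IH; case: ifP => _; rewrite ?addnA.
Qed.

Definition bulk (w : site -> bool) : nat -> nat -> bool :=
  fun i j => w (i.+1, j).

Lemma path_weight_le_lpp w q : path up_right (0, 0)%N q ->
  (path_weight w (0, 0)%N q <=
   lpp (bulk w) (last (0, 0)%N q).1 (last (0, 0)%N q).2)%N.
Proof.
elim/last_ind: q => [|q z IH].
  by move=> _; rewrite /path_weight big_nil.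
rewrite rcons_path => /andP[/IH {}IH]; rewrite path_weight_rcons last_rcons.
set l := last _ _ in IH *; case/orP => /eqP ->.
  rewrite eqxx mul1n; apply: leq_trans (lpp_step (bulk w) l.1 l.2).
  by rewrite leq_add2r.
case: eqP => [[]|_]; first by lia.
by rewrite mul0n addn0; apply: (leq_trans IH); apply: lpp_leS.
Qed.

Lemma lpp_path w m n : exists2 q, admissible (0, 0)%N (m, n) q &
  path_weight w (0, 0)%N q = lpp (bulk w) m n.
Proof.
have step1 q i j : admissible (0, 0)%N (i, j) q ->
    admissible (0, 0)%N (i.+1, j) (rcons q (i.+1, j)) /\
    path_weight w (0, 0)%N (rcons q (i.+1, j)) =
    (path_weight w (0, 0)%N q + bulk w i j)%N.
  move=> /andP[pq /eqP lq]; split.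
    by rewrite /admissible rcons_path pq lq last_rcons/= eqxx andbT /up_right eqxx.
  by rewrite path_weight_rcons lq eqxx mul1n.
have step2 q i j : admissible (0, 0)%N (i, j) q ->
    admissible (0, 0)%N (i, j.+1) (rcons q (i, j.+1)) /\
    path_weight w (0, 0)%N (rcons q (i, j.+1)) = path_weight w (0, 0)%N q.
  move=> /andP[pq /eqP lq]; split.
    by rewrite /admissible rcons_path pq lq last_rcons/= eqxx andbT /up_right
      [X in _ || X]eqxx orbT.
  rewrite path_weight_rcons lq; case: eqP => [[]|_]; first by lia.
  by rewrite mul0n addn0.
elim: m n => [|m IHm].
  elim=> [|n [q /step2[aq wq] qw]].
    by exists [::]; rewrite // /path_weight big_nil.
  by exists (rcons q (0%N, n.+1)) => //; rewrite wq.
elim=> [|n [q' /step2[aq' wq'] q'w]].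
  have [q /step1[aq wq] qw] := IHm 0%N.
  by exists (rcons q (m.+1, 0%N)) => //; rewrite wq qw.
have [q /step1[aq wq] qw] := IHm n.+1.
rewrite lppSS; case: (leqP (lpp (bulk w) m n.+1 + bulk w m n.+1) (lpp (bulk w) m.+1 n)) => _.
  by exists (rcons q' (m.+1, n.+1)) => //; rewrite wq'.
by exists (rcons q (m.+1, n.+1)) => //; rewrite wq qw.
Qed.

(** Removing the last step of an admissible path gives one bound, extending an
    optimal path by the step that realizes the recursion gives the other. *)
Lemma last_passageE w m n :
  last_passage w (0, 0)%N (m, n) = lpp (bulk w) m n.
Proof.
apply/eqP; rewrite eqn_leq /last_passage; apply/andP; split.
  apply/bigmax_leqP_seq => q; rewrite mem_paths => /andP[pq /eqP lq] _.
  by have := path_weight_le_lpp w pq; rewrite lq.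
have [q aq <-] := lpp_path w m n.
by apply: leq_bigmax_seq; rewrite ?mem_paths.
Qed.

(** * Expectations over finitely many Bernoulli bits *)

Section BernoulliExpectation.
Context {R : realType}.
Implicit Types (a b : R) (f g : seq bool -> R).

(** The expectation of [f] over [n] independent Bernoulli([a]) bits, with the
    bits drawn one after the other: independence is then the nesting of the
    operators, and linearity and monotonicity are inductions on [n]. *)
Fixpoint Ebits a n f : R :=
  if n is n'.+1 then
    a * Ebits a n' (f \o cons true) + (1 - a) * Ebits a n' (f \o cons false)
  else f [::].

Lemma eq_Ebits a n f g :
  (forall s, size s = n -> f s = g s) -> Ebits a n f = Ebits a n g.
Proof.
elim: n f g => [|n IH] f g h /=; first exact: h.
by congr (_ * _ + _ * _); apply: IH => s sn; apply: h; rewrite /= sn.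
Qed.

Lemma Ebits_le a n f g : 0 <= a <= 1 ->
  (forall s, size s = n -> f s <= g s) -> Ebits a n f <= Ebits a n g.
Proof.
move=> a01; elim: n f g => [|n IH] f g h /=; first exact: h.
by apply: lerD; apply: ler_wpM2l; rewrite ?subr_ge0; try (by case/andP: a01);
  apply: IH => s sn; apply: h; rewrite /= sn.
Qed.

Lemma EbitsZ a n c f : Ebits a n (fun s => c * f s) = c * Ebits a n f.
Proof. by elim: n f => [//|n IH] f /=; rewrite !IH; ring. Qed.

Lemma EbitsD a n f g : Ebits a n (fun s => f s + g s) = Ebits a n f + Ebits a n g.
Proof. by elim: n f g => [//|n IH] f g /=; rewrite !IH; ring. Qed.

Lemma Ebits_cst a n c : Ebits a n (fun=> c) = c.
Proof. by elim: n => [//|n IH] /=; rewrite !IH; ring. Qed.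

Lemma EbitsZr a n c f : Ebits a n (fun s => f s * c) = Ebits a n f * c.
Proof. by rewrite mulrC -EbitsZ; apply: eq_Ebits => s _; rewrite mulrC. Qed.

Lemma Ebits_sum a n k (F : nat -> seq bool -> R) :
  Ebits a n (fun s => \sum_(i < k) F i s) = \sum_(i < k) Ebits a n (F i).
Proof.
elim: k => [|k IH].
  by rewrite big_ord0 -[RHS](Ebits_cst a n 0); apply: eq_Ebits => s _; rewrite big_ord0.
rewrite big_ord_recr/= -IH -EbitsD; apply: eq_Ebits => s _.
by rewrite big_ord_recr.
Qed.

Lemma Ebits_cat a m n f :
  Ebits a (m + n) f = Ebits a m (fun s => Ebits a n (fun t => f (s ++ t))).
Proof. by elim: m f => [//|m IH] f /=; rewrite !IH. Qed.

Lemma Ebits_drop a k m f : Ebits a (k + m) (f \o drop k) = Ebits a m f.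
Proof.
rewrite Ebits_cat -[RHS](Ebits_cst a k); apply: eq_Ebits => s sk.
by apply: eq_Ebits => t _ /=; rewrite drop_size_cat.
Qed.

Lemma Ebits_norm_le a n f (M : R) : 0 <= a <= 1 ->
  (forall s, size s = n -> `|f s| <= M) -> `|Ebits a n f| <= M.
Proof.
move=> a01 h; rewrite ler_norml -[- M](Ebits_cst a n) -[X in _ && (_ <= X)](Ebits_cst a n).
by apply/andP; split; apply: Ebits_le => // s /h; rewrite ler_norml => /andP[].
Qed.

Implicit Types (F : seq (seq bool) -> R).

(** Bits arranged in [n] rows of length [m]: the Burke property treats one row
    at a time. *)
Fixpoint Erows a m n F : R :=
  if n is n'.+1 then Ebits a m (fun r => Erows a m n' (F \o cons r)) else F [::].

Lemma eq_Erows a m n F F' :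
  (forall rs, size rs = n -> all (fun r => size r == m) rs -> F rs = F' rs) ->
  Erows a m n F = Erows a m n F'.
Proof.
elim: n F F' => [|n IH] F F' h /=; first exact: h.
apply: eq_Ebits => s sm; apply: IH => rs rn rm; apply: h; rewrite /= ?rn//.
by rewrite sm eqxx.
Qed.

Lemma Erows_le a m n F F' : 0 <= a <= 1 ->
  (forall rs, size rs = n -> all (fun r => size r == m) rs -> F rs <= F' rs) ->
  Erows a m n F <= Erows a m n F'.
Proof.
move=> a01; elim: n F F' => [|n IH] F F' h /=; first exact: h.
apply: Ebits_le => // s sm; apply: IH => rs rn rm; apply: h; rewrite /= ?rn//.
by rewrite sm eqxx.
Qed.

Lemma ErowsZ a m n c F : Erows a m n (fun s => c * F s) = c * Erows a m n F.
Proof.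
by elim: n F => [//|n IH] F /=; rewrite -EbitsZ; apply: eq_Ebits => s _; rewrite -IH.
Qed.

Lemma ErowsD a m n F F' :
  Erows a m n (fun s => F s + F' s) = Erows a m n F + Erows a m n F'.
Proof.
by elim: n F F' => [//|n IH] F F' /=; rewrite -EbitsD; apply: eq_Ebits => s _;
  rewrite -IH.
Qed.

Lemma Erows_cst a m n c : Erows a m n (fun=> c) = c.
Proof.
by elim: n => [//|n IH] /=; rewrite -[RHS](Ebits_cst a m); apply: eq_Ebits => s _.
Qed.

Lemma Erows_sum a m n k (F : nat -> seq (seq bool) -> R) :
  Erows a m n (fun s => \sum_(i < k) F i s) = \sum_(i < k) Erows a m n (F i).
Proof.
elim: k => [|k IH].
  by rewrite big_ord0 -[RHS](Erows_cst a m n 0); apply: eq_Erows => s _; rewrite big_ord0.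
rewrite big_ord_recr/= -IH -ErowsD; apply: eq_Erows => s _ _.
by rewrite big_ord_recr.
Qed.

Lemma Erows_drop_rows a m k n F : Erows a m (k + n) (F \o drop k) = Erows a m n F.
Proof.
elim: k => [|k IH] /=.
  by apply: eq_Erows => rs _ _ /=; rewrite drop0.
rewrite -[RHS](Ebits_cst a m); apply: eq_Ebits => s _; rewrite -IH.
by apply: eq_Erows.
Qed.

Lemma Erows_drop_cols a k m n F :
  Erows a (k + m) n (F \o map (drop k)) = Erows a m n F.
Proof.
elim: n F => [//|n IH] F /=.
rewrite -(Ebits_drop a k m (fun r => Erows a m n (F \o cons r))).
apply: eq_Ebits => s _ /=.
by rewrite -IH; apply: eq_Erows.
Qed.

Lemma Erows_reshape a m sh F : all (fun k => k == m) sh ->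
  Ebits a (sumn sh) (F \o reshape sh) = Erows a m (size sh) F.
Proof.
elim: sh F => [//|k sh IH] F /= /andP[/eqP -> shm].
rewrite Ebits_cat; apply: eq_Ebits => s sm; rewrite -IH//.
by apply: eq_Ebits => t _ /=; rewrite take_size_cat// drop_size_cat.
Qed.

End BernoulliExpectation.

(** * The law of the weights *)

Section Law.
Context d (T : measurableType d) (R : realType) (P : probability T R) (p : R).
Variable omega : site -> {RV P >-> bool}.
Hypothesis iid : iid_bernoulli p omega.

Let w (b : bool) : R := if b then p else 1 - p.

Let meas_site v b : measurable [set x | omega v x = b].
Proof.
have -> : [set x | omega v x = b] = omega v @^-1` [set b] by [].
by rewrite -[X in measurable X]setTI; apply: (measurable_funP (omega v)).
Qed.

Let prob_site v b : P [set x | omega v x = b] = (w b)%:E.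
Proof.
case: iid => h _; have ht : P [set x | omega v x = true] = p%:E by exact: h.
case: b => //=; have -> : [set x | omega v x = false] =
    ~` [set x | omega v x = true].
  by apply/seteqP; split => x /=; case: (omega v x).
by rewrite probability_setC// ht.
Qed.

Lemma measurable_sites (Q : set T) ss (A : pred (seq bool)) : measurable Q ->
  measurable [set x | Q x /\ A (map (fun v => omega v x) ss)].
Proof.
elim: ss Q A => [|v ss IH] Q A mQ /=.
  case: (A [::]).
    by rewrite (_ : [set x | _] = Q)//; apply/seteqP; split => x //= [].
  by rewrite (_ : [set x | _] = set0)//; apply/seteqP; split => x /= [].
rewrite (_ : [set x | _] =
  [set x | (Q x /\ omega v x = true) /\ (A \o cons true) (map (fun v => omega v x) ss)] `|`
  [set x | (Q x /\ omega v x = false) /\ (A \o cons false) (map (fun v => omega v x) ss)]).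
  by apply: measurableU; apply: IH; apply: measurableI => //; apply: meas_site.
apply/seteqP; split => x /=.
  by case: (omega v x) => -[Qx Ax]; [left|right].
by case=> -[[? ->] ?].
Qed.

Let cyl (tt : seq site) (beta : site -> bool) : set T :=
  [set x | forall v, v \in tt -> omega v x = beta v].

Let cyl_cons v tt beta : cyl (v :: tt) beta =
  cyl tt beta `&` [set x | omega v x = beta v].
Proof.
apply/seteqP; split => x /= h.
  by split; [move=> u ut; apply: h; rewrite inE ut orbT|apply: h; rewrite inE eqxx].
by case: h => h1 h2 u; rewrite inE => /orP[/eqP ->//|]; apply: h1.
Qed.

Let meas_cyl tt beta : measurable (cyl tt beta).
Proof.
elim: tt => [|v tt IH].
  by rewrite (_ : cyl _ _ = setT)//; apply/seteqP; split.
by rewrite cyl_cons; apply: measurableI.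
Qed.

Let prob_cyl tt beta : uniq tt ->
  P (cyl tt beta) = (\prod_(v <- tt) w (beta v))%:E.
Proof.
move=> ut; case: iid => _ /(_ tt (fun v => [set beta v]) ut) h.
rewrite (_ : cyl _ _ = \bigcap_(i in [set` tt]) (omega i @^-1` [set beta i])).
  rewrite h// -prodEFin; apply: eq_bigr => v _; exact: prob_site.
by apply/seteqP; split => x /= hx v /=; apply: hx.
Qed.

(** Reveal the sites of [ss] one by one.  Each revealed site joins the cylinder,
    whose probability factorizes by independence. *)
Let prob_cyl_sites tt beta ss (A : pred (seq bool)) : uniq (tt ++ ss) ->
  P [set x | cyl tt beta x /\ A (map (fun v => omega v x) ss)] =
  ((\prod_(v <- tt) w (beta v)) * Ebits p (size ss) (fun bs => (A bs)%:R))%:E.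
Proof.
elim: ss tt beta A => [|v ss IH] tt beta A; rewrite ?cats0 => uts /=.
  case: (A [::]) => /=.
    rewrite mulr1 -prob_cyl//; congr (P _).
    by apply/seteqP; split => x //= [].
  rewrite mulr0 (_ : [set x | _] = set0) ?measure0//.
  by apply/seteqP; split => x /= [].
pose beta' b := fun u => if u == v then b else beta u.
pose U b := [set x | cyl (v :: tt) (beta' b) x /\
                     (A \o cons b) (map (fun v => omega v x) ss)].
have uvt : uniq ((v :: tt) ++ ss).
  by rewrite -(perm_uniq (_ : perm_eq (tt ++ v :: ss) _))// perm_catC/= perm_cons perm_catC.
have vtt : v \notin tt by move: uvt => /= /andP[]; rewrite mem_cat negb_or => /andP[].
have betaE b u : u \in tt -> beta' b u = beta u.
  by move=> utt; rewrite /beta'; case: eqP utt vtt => // -> ->.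
have mU b : measurable (U b) by apply: measurable_sites.
have UE b : U b `<=` [set x | omega v x = b].
  by move=> x [+ _]; rewrite cyl_cons => -[_ /=]; rewrite /beta' eqxx.
rewrite (_ : [set x | _] = U true `|` U false); last first.
  apply/seteqP; split => x /=.
    case=> h1 h2; case E: (omega v x) h2 => h2; [left|right]; split => //;
    by rewrite cyl_cons; split; [move=> u ut; rewrite betaE// h1
                                |rewrite /= /beta' eqxx].
  case=> xU; have := UE _ _ xU => /= E; rewrite E; case: xU; rewrite cyl_cons
    => -[h1 _] h2; by split => // u ut; rewrite h1// betaE.
rewrite measureU//; last first.
  by apply/seteqP; split => x //= -[/UE /= E1 /UE /= E2]; move: E1; rewrite E2.
have prodE b : \prod_(u <- v :: tt) w (beta' b u) =
    w b * \prod_(u <- tt) w (beta u).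
  rewrite big_cons {1}/beta' eqxx; congr (_ * _).
  by apply: eq_big_seq => u ut; rewrite betaE.
have PU b : P (U b) = (w b * \prod_(u <- tt) w (beta u) *
    Ebits p (size ss) ((fun bs => (A bs)%:R) \o cons b))%:E.
  by rewrite -prodE; apply: IH.
by rewrite /= !PU -EFinD; congr (_%:E); rewrite /w; ring.
Qed.

(** Independence and the common law of the weights enter the sequel only through
    this identity. *)
Lemma bits_law ss (A : pred (seq bool)) : uniq ss ->
  P [set x | A (map (fun v => omega v x) ss)] =
  (Ebits p (size ss) (fun bs => (A bs)%:R))%:E.
Proof.
move=> uss; rewrite -[RHS]mul1e; have := @prob_cyl_sites [::] xpredT ss A uss.
rewrite big_nil mul1r mul1e => <-; congr (P _).
by apply/seteqP; split => x //= [].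
Qed.

Lemma rows_law m (rs0 : seq (seq site)) (A : pred (seq (seq bool))) :
  uniq (flatten rs0) -> all (fun r => size r == m) rs0 ->
  P [set x | A (map (map (fun v => omega v x)) rs0)] =
  (Erows p m (size rs0) (fun rs => (A rs)%:R))%:E.
Proof.
move=> urs rsm; rewrite -(size_map size rs0) -/(shape rs0) -Erows_reshape; last first.
  by rewrite all_map.
rewrite -size_flatten -[in RHS](bits_law (A \o reshape (shape rs0)))//.
congr (P _); apply/seteqP; split => x /=; by rewrite -map_reshape flattenK.
Qed.

Lemma sites_indep ss1 ss2 (A1 A2 : pred (seq bool)) : uniq (ss1 ++ ss2) ->
  P [set x | A1 (map (fun v => omega v x) ss1) && A2 (map (fun v => omega v x) ss2)] =
  (P [set x | A1 (map (fun v => omega v x) ss1)] *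
   P [set x | A2 (map (fun v => omega v x) ss2)])%E.
Proof.
move=> u12; have := u12; rewrite cat_uniq => /and3P[u1 _ u2].
pose A s := A1 (take (size ss1) s) && A2 (drop (size ss1) s).
rewrite !bits_law// -EFinM -EbitsZr (_ : [set x | _] =
  [set x | A (map (fun v => omega v x) (ss1 ++ ss2))]).
  rewrite bits_law// size_cat Ebits_cat; congr (_%:E); apply: eq_Ebits => s s1.
  rewrite -EbitsZ; apply: eq_Ebits => t t1.
  by rewrite /A take_size_cat// drop_size_cat// -natrM mulnb.
apply/seteqP; split => x /=; rewrite /A map_cat take_size_cat ?drop_size_cat ?size_map//.
Qed.
End Law.

(** * Tail probabilities and moment generating functions *)

Definition config_of_rows (rs : seq (seq bool)) (i j : nat) : bool :=
  nth false (nth [::] rs j) i.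

Definition tail_prob (R : realType) (p : R) (m n : nat) (y : R) : R :=
  Erows p m n.+1 (fun rs => (y <= (lpp (config_of_rows rs) m n)%:R)%R%:R).

Definition mgf (R : realType) (p x : R) (m n : nat) : R :=
  Erows p m n.+1 (fun rs => x ^+ lpp (config_of_rows rs) m n).

(** The sites whose weights determine the last passage value from [(a, b)] to
    [(a + m, b + n)]: weights sit at the end points of horizontal steps, hence
    the shift by one in the first coordinate only. *)
Definition box (a b m n : nat) : seq (seq site) :=
  [seq [seq ((a + i).+1, (b + j)%N) | i <- iota 0 m] | j <- iota 0 n.+1].

Lemma config_of_rows_box (w : site -> bool) a b m n i j : (i < m)%N -> (j <= n)%N ->
  config_of_rows (map (map w) (box a b m n)) i j = shift a b (bulk w) i j.
Proof.
move=> im jn; rewrite /config_of_rows /box.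
rewrite (nth_map [::]) ?size_map ?size_iota//.
rewrite (nth_map 0%N) ?size_iota// nth_iota//.
rewrite (nth_map (0, 0)%N) ?size_map ?size_iota//.
by rewrite (nth_map 0%N) ?size_iota// nth_iota.
Qed.

Lemma lpp_box (w : site -> bool) a b m n :
  lpp (config_of_rows (map (map w) (box a b m n))) m n = lpp (shift a b (bulk w)) m n.
Proof. by apply: eq_lpp => i j im jn; apply: config_of_rows_box. Qed.

Lemma uniq_box a b m n : uniq (flatten (box a b m n)).
Proof.
apply: allpairs_uniq; rewrite ?iota_uniq// => -[j i] [j' i'] _ _ /= [].
by move=> /addnI -> /addnI ->.
Qed.

Lemma mem_box a b m n v : v \in flatten (box a b m n) ->
  (a < v.1 <= a + m)%N.
Proof.
case/flattenP => r /mapP[j _ ->] /mapP[i]; rewrite mem_iota => im -> /=.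
by lia.
Qed.

Lemma size_box a b m n : size (box a b m n) = n.+1.
Proof. by rewrite size_map size_iota. Qed.

Lemma all_size_box a b m n : all (fun r => size r == m) (box a b m n).
Proof. by rewrite all_map; apply/allP => j _ /=; rewrite size_map size_iota. Qed.

Section Tail.
Context d (T : measurableType d) (R : realType) (P : probability T R) (p : R).
Variable omega : site -> {RV P >-> bool}.
Hypothesis p01 : 0 < p < 1.
Hypothesis iid : iid_bernoulli p omega.
Implicit Types (y z : R).

Let p01w : 0 <= p <= 1. Proof. by case/andP: p01 => ? ?; rewrite !ltW. Qed.

Let ge_lpp (a b m n : nat) y : pred (seq bool) := fun s =>
  y <= (lpp (config_of_rows (reshape (shape (box a b m n)) s)) m n)%:R.

Let ge_lppE a b m n y x :
  ge_lpp a b m n y (map (fun v => omega v x) (flatten (box a b m n))) =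
  (y <= (lpp (shift a b (bulk (fun v => omega v x))) m n)%:R).
Proof. by rewrite /ge_lpp -map_reshape flattenK lpp_box. Qed.

Let lpp_law a b m n y :
  P [set x | y <= (lpp (shift a b (bulk (fun v => omega v x))) m n)%:R] =
  (tail_prob p m n y)%:E.
Proof.
have := @rows_law _ _ _ _ _ _ iid m (box a b m n)
  (fun rs => y <= (lpp (config_of_rows rs) m n)%:R) (uniq_box _ _ _ _) (all_size_box _ _ _ _).
rewrite size_box => <-; congr (P _); apply/seteqP.
by split => x /=; rewrite lpp_box.
Qed.

Lemma G_law m n y : P [set x | y <= (G omega m n x)%:R] = (tail_prob p m n y)%:E.
Proof.
rewrite -(lpp_law 0 0); congr (P _); apply/seteqP.
by split => x /=; rewrite /G last_passageE.
Qed.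

Let measurable_lpp a b m n y :
  measurable [set x | y <= (lpp (shift a b (bulk (fun v => omega v x))) m n)%:R].
Proof.
have := @measurable_sites _ _ _ _ omega setT (flatten (box a b m n))
  (ge_lpp a b m n y) measurableT.
congr (measurable _); apply/seteqP; split => x /=; rewrite ge_lppE; tauto.
Qed.

(** Passage through [(m, n)] splits the weights into two boxes with no common
    site, so that superadditivity of last passage values turns into
    supermultiplicativity of tail probabilities. *)
Lemma tail_prob_superadd m n m' n' y z :
  tail_prob p m n y * tail_prob p m' n' z <= tail_prob p (m + m') (n + n') (y + z).
Proof.
rewrite -lee_fin EFinM -(lpp_law 0 0 m) -(lpp_law m n m') -(lpp_law 0 0 (m + m')).
have u12 : uniq (flatten (box 0 0 m n) ++ flatten (box m n m' n')).
  rewrite cat_uniq !uniq_box/= andbT; apply/hasPn => v /mem_box h.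
  by apply/negP => /mem_box; lia.
have := sites_indep iid (ge_lpp 0 0 m n y) (ge_lpp m n m' n' z) u12.
rewrite (_ : [set x | ge_lpp 0 0 m n y _] =
  [set x | y <= (lpp (shift 0 0 (bulk (fun v => omega v x))) m n)%:R]); last first.
  by apply/seteqP; split => x /=; rewrite ge_lppE.
rewrite (_ : [set x | ge_lpp m n m' n' z _] =
  [set x | z <= (lpp (shift m n (bulk (fun v => omega v x))) m' n')%:R]); last first.
  by apply/seteqP; split => x /=; rewrite ge_lppE.
move=> <-; rewrite (_ : [set x | _ && _] =
  [set x | y <= (lpp (shift 0 0 (bulk (fun v => omega v x))) m n)%:R] `&`
  [set x | z <= (lpp (shift m n (bulk (fun v => omega v x))) m' n')%:R]); last first.
  apply/seteqP; split => x /=; rewrite !ge_lppE; first by move/andP.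
  by case=> -> ->.
apply: le_measure; rewrite ?inE.
- by apply: measurableI; apply: measurable_lpp.
- exact: measurable_lpp.
move=> x [/= h1 h2]; apply: le_trans (lerD h1 h2) _.
by rewrite -natrD ler_nat; apply: lpp_superadd.
Qed.

Lemma tail_prob_mono m n m' n' y z : (m <= m')%N -> (n <= n')%N -> z <= y ->
  tail_prob p m n y <= tail_prob p m' n' z.
Proof.
move=> mm' nn' zy; rewrite -lee_fin -!(lpp_law 0 0).
apply: le_measure; rewrite ?inE; [exact: measurable_lpp..|].
move=> x /= h; apply: le_trans zy (le_trans h _).
by rewrite ler_nat; apply: lpp_mono.
Qed.

Lemma tail_prob_le1 m n y : tail_prob p m n y <= 1.
Proof.
rewrite -(Erows_cst p m n.+1 1); apply: Erows_le => // rs _ _.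
by rewrite lern1 leq_b1.
Qed.

Lemma tail_prob_ge0 m n y : 0 <= tail_prob p m n y.
Proof. by rewrite -(Erows_cst p m n.+1 0); apply: Erows_le => // rs _ _. Qed.

Lemma tail_prob_npos m n y : y <= 0 -> tail_prob p m n y = 1.
Proof.
move=> y0; rewrite -[RHS](Erows_cst p m n.+1 1); apply: eq_Erows => rs _ _.
by rewrite (le_trans y0).
Qed.

(** All weights on the bottom row are equal to one with probability [p ^+ m]. *)
Lemma tail_prob_ge_pow m n y : y <= m%:R -> p ^+ m <= tail_prob p m n y.
Proof.
move=> ym.
have Eball k : Ebits p k (fun s => (all id s)%:R) = p ^+ k.
  elim: k => [//|k IH] /=; rewrite exprS -IH.
  rewrite [X in _ + _ * X](_ : _ = 0) ?mulr0 ?addr0//.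
  by rewrite -[RHS](Ebits_cst p k 0); apply: eq_Ebits.
pose ss := [seq (i.+1, 0%N) | i <- iota 0 m] : seq site.
have uss : uniq ss by rewrite map_inj_uniq ?iota_uniq// => i j [].
have := bits_law iid (all id) uss; rewrite size_map size_iota Eball => h.
rewrite -lee_fin -h -(lpp_law 0 0).
have mA : measurable [set x | all id [seq omega v x | v <- ss]].
  have := @measurable_sites _ _ _ _ omega setT ss (all id) measurableT.
  by congr (measurable _); apply/seteqP; split => x /=; tauto.
apply: le_measure; rewrite ?inE//.
move=> x /= /allP a; apply: (le_trans ym); rewrite ler_nat; apply: lpp_row_full => i im.
apply: (a (omega (i.+1, 0%N) x)); apply/mapP; exists (i.+1, 0%N) => //.
by apply/mapP; exists i; rewrite // mem_iota.
Qed.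

(** A crude converse to the exponential Markov inequality; the loss is the
    number of terms, which is polynomial in [m]. *)
Lemma mgf_le_sum_tail_prob x m n : 1 <= x ->
  mgf p x m n <= \sum_(k < m.+1) x ^+ k * tail_prob p m n k%:R.
Proof.
move=> x1; have x0 : 0 <= x by apply: le_trans x1.
under eq_bigr do rewrite -ErowsZ.
rewrite -(Erows_sum p m n.+1 m.+1 (fun k rs => x ^+ k * (k%:R <= (lpp (config_of_rows rs) m n)%:R)%R%:R)).
apply: Erows_le => // rs _ _.
have lm : (lpp (config_of_rows rs) m n < m.+1)%N by rewrite ltnS lpp_le.
rewrite (bigD1 (Ordinal lm))//= lexx mulr1 lerDl.
by apply: sumr_ge0 => i _; rewrite mulr_ge0 ?exprn_ge0.
Qed.

End Tail.

(** * Last passage with boundary increments *)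

(** Last passage values with prescribed values [SI] along the bottom and [SH]
    along the left side.  The bulk row [j] is read by the values at height
    [j.+1], because the boundary occupies height [0]. *)
Fixpoint lpp_bd (SI SH : nat -> nat) (c : nat -> nat -> bool) (m n : nat) : nat :=
  if m is i.+1 then
    (fix lpp_bd_row (n : nat) : nat :=
       if n is j.+1 then maxn (lpp_bd SI SH c i j.+1 + c i j) (lpp_bd_row j)
       else SI i.+1) n
  else SH n.

Lemma lpp_bdSS SI SH c i j : lpp_bd SI SH c i.+1 j.+1 =
  maxn (lpp_bd SI SH c i j.+1 + c i j) (lpp_bd SI SH c i.+1 j).
Proof. by []. Qed.

(** The path may take one step along the left boundary, where it cannot lose, and
    then use the bulk only. *)
Lemma lpp_le_lpp_bd SI SH c m n : (lpp c m n <= lpp_bd SI SH c m n.+1)%N.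
Proof.
elim: m n => [//|m IHm]; elim=> [|n IHn].
  by rewrite lppS0 lpp_bdSS; apply: leq_trans (leq_maxl _ _); rewrite leq_add2r.
rewrite lppSS lpp_bdSS geq_max (leq_trans _ (leq_maxl _ _)) ?leq_add2r//=.
exact: leq_trans IHn (leq_maxr _ _).
Qed.

(** An optimal path leaves the boundary at some point, either on the bottom at
    column [k] or on the left after [l.+1] vertical increments, and stays in the
    bulk afterwards. *)
Lemma lpp_bd_exit SI SH c m n :
  (exists2 k, (k <= m)%N &
    (lpp_bd SI SH c m n.+1 <= SI k + lpp (shift k 0 c) (m - k) n)%N) \/
  (exists2 l, (l <= n)%N &
    (lpp_bd SI SH c m n.+1 <= SH l.+1 + lpp (shift 0 l c) m (n - l))%N).
Proof.
elim: m n => [|m IHm] n.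
  by right; exists n; rewrite // leq_addr.
elim: n => [|n IHn]; rewrite lpp_bdSS.
  case: leqP => _; first by left; exists m.+1; rewrite // leq_addr.
  case: (IHm 0%N) => -[k km h]; [left; exists k; first exact: leqW|right; exists k => //].
    apply: leq_trans (leq_add h (leqnn _)) _; rewrite subSn// -addnA leq_add2l.
    by have := lpp_step (shift k 0 c) (m - k) 0; rewrite /shift subnKC.
  move: km h; rewrite leqn0 => /eqP -> h; rewrite subnn.
  apply: leq_trans (leq_add h (leqnn _)) _; rewrite -addnA leq_add2l.
  exact: lpp_step (shift 0 0 c) m 0%N.
case: leqP => _.
  case: IHn => -[k km h]; [left; exists k => //|right; exists k; first exact: leqW].
    by apply: (leq_trans h); rewrite leq_add2l; apply: lpp_mono.
  by apply: (leq_trans h); rewrite leq_add2l; apply: lpp_mono; rewrite // leq_sub2r.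
case: (IHm n.+1) => -[k km h]; [left; exists k; first exact: leqW|right; exists k => //].
  apply: leq_trans (leq_add h (leqnn _)) _; rewrite subSn// -addnA leq_add2l.
  by have := lpp_step (shift k 0 c) (m - k) n.+1; rewrite /shift subnKC.
apply: leq_trans (leq_add h (leqnn _)) _; rewrite -addnA leq_add2l.
by have := lpp_step (shift 0 k c) m (n.+1 - k); rewrite /shift subnKC.
Qed.

(** The values on the first row above the bottom are a new bottom boundary for
    the rows above. *)
Lemma lpp_bd_first_row SI SH c i j :
  (forall i, SH 1%N <= lpp_bd SI SH c i 1)%N -> (forall j, SH 1%N <= SH j.+1)%N ->
  lpp_bd SI SH c i j.+1 =
  (SH 1%N + lpp_bd (fun i => lpp_bd SI SH c i 1 - SH 1)
     (fun j => SH j.+1 - SH 1) (shift 0 1 c) i j)%N.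
Proof.
move=> hI hH; elim: i j => [|i IHi] j; first by rewrite /= subnKC.
elim: j => [|j IHj]; first exact: esym (subnKC (hI i.+1)).
by rewrite lpp_bdSS [in RHS]lpp_bdSS IHi IHj addn_maxr addnA.
Qed.

Lemma eq_lpp_bd SI SI' SH SH' c c' m n :
  (forall i, (i <= m)%N -> SI i = SI' i) -> (forall j, (j <= n)%N -> SH j = SH' j) ->
  (forall i j, (i < m)%N -> (j < n)%N -> c i j = c' i j) ->
  lpp_bd SI SH c m n = lpp_bd SI' SH' c' m n.
Proof.
elim: m n => [|m IHm] n hI hH hc; first exact: hH.
elim: n hH hc => [|n IHn] hH hc; first by apply: hI.
rewrite !lpp_bdSS IHn; last first.
- by move=> i j im jn; apply: hc => //; apply: leqW.
- by move=> j jn; apply: hH; apply: leqW.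
rewrite hc// IHm//.
- by move=> i im; apply: hI; apply: leqW.
- by move=> i j im jn; apply: hc => //; apply: ltnW.
Qed.

(** Increments around a unit square with weight [w]: from the increment [b]
    along the bottom and [h] along the left side to those along the top and the
    right side.  The truncated subtraction is the positive part in
    max (w + h - b) 0. *)
Definition corner_step (b : bool) (h : nat) (w : bool) : bool * nat :=
  (w || b && (h == 0%N), (w + h - b)%N).

(** Corner steps from left to right: the vertical increment [h] travels through
    the row, while the horizontal increments [Is] are replaced by those along the
    top of the row.  The second component is the vertical increment on the right
    side. *)
Fixpoint row_update (h : nat) (Is ws : seq bool) : seq bool * nat :=
  if Is is b :: Is' then if ws is w :: ws' then
    let r := row_update (corner_step b h w).2 Is' ws' in ((corner_step b h w).1 :: r.1, r.2)
  else ([::], h) else ([::], h).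

Lemma size_row_update h Is ws : size Is = size ws -> size (row_update h Is ws).1 = size Is.
Proof. by elim: Is ws h => [//|b Is IH] [//|w ws] h /= [/IH ->]. Qed.

Definition prefix_count (s : seq bool) (i : nat) : nat := count id (take i s).

Lemma row_update_rec h Is ws i : size Is = size ws -> (i < size Is)%N ->
  (h + prefix_count (row_update h Is ws).1 i.+1)%N =
  maxn (h + prefix_count (row_update h Is ws).1 i + nth false ws i) (prefix_count Is i.+1).
Proof.
rewrite /prefix_count; elim: Is ws h i => [//|b Is IH] [//|w ws] h i [sz].
case: i => [_|i]; first by rewrite /= !take0/=; case: w; case: b; case: h => //=; lia.
rewrite ltnS => /(IH _ (corner_step b h w).2 _ sz)/=.
by move: (count _ (take i.+1 _)) (count _ (take i _)) (count _ (take i.+1 _));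
  case: w; case: b; case: h => [|h] //=; lia.
Qed.

Lemma lpp_bd_row1 h Is ws SH c i : size Is = size ws -> SH 1%N = h ->
  (i <= size Is)%N -> (forall i, (i < size Is)%N -> c i 0%N = nth false ws i) ->
  lpp_bd (prefix_count Is) SH c i 1 = (h + prefix_count (row_update h Is ws).1 i)%N.
Proof.
move=> sz hh im hc; elim: i im => [|i IH] im; first by rewrite /= /prefix_count take0 addn0.
by rewrite lpp_bdSS IH 1?ltnW// hc// row_update_rec.
Qed.

Fixpoint run_rows (Is : seq bool) (hs : seq nat) (rs : seq (seq bool)) : seq bool :=
  if hs is h :: hs' then if rs is ws :: rs' then run_rows (row_update h Is ws).1 hs' rs'
  else Is else Is.

(** The increments along the top add up to the last passage value at the top
    right corner minus the total increment of the left side. *)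
Lemma lpp_bd_run m Is hs rs : size Is = m -> size hs = size rs ->
  all (fun r => size r == m) rs ->
  lpp_bd (prefix_count Is) (fun j => sumn (take j hs)) (config_of_rows rs) m (size rs) =
  (sumn hs + count id (run_rows Is hs rs))%N.
Proof.
elim: rs Is hs => [|r rs IH] Is [|h hs]//= szI.
  move=> _ _; rewrite add0n /prefix_count.
  by case: m szI => [/size0nil -> //|m szI]; rewrite /= /prefix_count take_oversize// szI.
move=> [szh] /andP[/eqP szr szrs].
set SH := fun j => sumn (take j (h :: hs)).
have SH1 : SH 1%N = h by rewrite /SH /= take0 /= addn0.
have szIr : size Is = size r by rewrite szI.
have row1 i : (i <= m)%N -> lpp_bd (prefix_count Is) SH (config_of_rows (r :: rs)) i 1 =
    (h + prefix_count (row_update h Is r).1 i)%N.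
  by move=> im; apply: lpp_bd_row1; rewrite // szI.
have row1ge i : (h <= lpp_bd (prefix_count Is) SH (config_of_rows (r :: rs)) i 1)%N.
  elim: i => [|i IHi]; first by rewrite /= SH1.
  by rewrite lpp_bdSS; apply: leq_trans (leq_maxl _ _); apply: leq_trans IHi (leq_addr _ _).
rewrite lpp_bd_first_row ?SH1//; last by move=> j; rewrite /SH /= leq_addr.
rewrite -addnA -IH ?size_row_update ?szI//; congr (_ + _)%N; apply: eq_lpp_bd => //.
- by move=> i im; rewrite row1// addKn.
- by move=> j _; rewrite /SH /= addKn.
Qed.

(** * The Burke property *)

Section Burke.
Context {R : realType} (p u q : R).
Hypotheses (p01 : 0 < p < 1) (pu1 : p < u <= 1) (q01 : 0 < q <= 1).
Hypothesis qE : u * (1 - p) * (1 - q) = (1 - u) * p.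

Let p01w : 0 <= p <= 1. Proof. by case/andP: p01 => ? ?; rewrite !ltW. Qed.
Let u01w : 0 <= u <= 1.
Proof. by case/andP: pu1 => pu ->; case/andP: p01 => p0 _; rewrite ltW// (lt_trans p0). Qed.

(** Geometric weights.  They are summed over [h < N] only, which keeps all sums
    finite; the price is the explicit boundary term in [burke_local], which
    disappears as [N] grows. *)
Definition geo (h : nat) : R := q * (1 - q) ^+ h.

Lemma geo_ge0 h : 0 <= geo h.
Proof.
case/andP: q01 => q0 q1; apply: mulr_ge0; first exact: ltW.
by rewrite exprn_ge0// subr_ge0.
Qed.

Definition bern_avg (a : R) (f : bool -> R) : R := a * f true + (1 - a) * f false.

(** The heart of the matter: if the two incoming increments and the weight are
    independent with laws Bernoulli([u]), geometric([q]) and Bernoulli([p]), then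
    the outgoing increments are independent with the same laws Bernoulli([u]) and
    geometric([q]).  With geometric sums cut at [N], the only defect is the mass
    that crosses the cut: it leaves at height [N.+1] and is missing at height
    [N]. *)
Lemma burke_local N (psi : bool -> nat -> R) :
  \sum_(h < N.+1) geo h *
     bern_avg u (fun b => bern_avg p (fun w => psi (corner_step b h w).1 (corner_step b h w).2)) =
  \sum_(h < N.+1) geo h * bern_avg u (psi^~ h) +
  u * (1 - p) * geo N.+1 * (psi true N.+1 - psi false N).
Proof.
have geoS k : u * (1 - p) * geo k.+1 = geo k * ((1 - u) * p).
  by rewrite /geo exprSr -qE; ring.
elim: N => [|N IH].
  by rewrite !big_ord1 geoS /bern_avg /corner_step /= subn0 subn1 /=; ring.
rewrite big_ord_recr IH [in RHS]big_ord_recr /= -!addrA; congr (_ + _).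
rewrite (geoS N.+1) /bern_avg /corner_step /= !subn0 (_ : (N.+1 == 0%N) = false)// add1n.
by rewrite (_ : 0 + N.+1 = N.+1)%N// (_ : N.+1 - 1 = N)%N ?subn1//; ring.
Qed.

Definition mass N : R := \sum_(h < N) geo h.

Lemma geo_sum N y : y * (1 - q) != 1 ->
  \sum_(h < N) geo h * y ^+ h = q * (1 - (y * (1 - q)) ^+ N) / (1 - y * (1 - q)).
Proof.
move=> h; have h' : 1 - y * (1 - q) != 0 by rewrite subr_eq0 eq_sym.
apply: (mulIf h'); rewrite mulfVK//.
elim: N => [|N IH]; first by rewrite big_ord0 expr0 subrr mulr0 mul0r.
by rewrite big_ord_recr mulrDl IH /geo /= exprS exprMn; ring.
Qed.

Lemma massE N : mass N = 1 - (1 - q) ^+ N.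
Proof.
elim: N => [|N IH]; first by rewrite /mass big_ord0 expr0 subrr.
by rewrite /mass big_ord_recr -/(mass N) IH /geo /= exprS; ring.
Qed.

Lemma mass_ge0 N : 0 <= mass N.
Proof. by apply: sumr_ge0 => i _; apply: geo_ge0. Qed.

Lemma mass_le1 N : mass N <= 1.
Proof.
by rewrite massE gerBl exprn_ge0// subr_ge0; case/andP: q01.
Qed.

Lemma bern_avg_norm_le a f M : 0 <= a <= 1 -> (forall b, `|f b| <= M) ->
  `|bern_avg a f| <= M.
Proof.
move=> a01 h; have := @Ebits_norm_le R a 1 (fun s => f (head true s)) M a01.
by apply => s _; apply: h.
Qed.

(** One corner step after the other; each of the [m] corners contributes one
    boundary term, of size at most [M *+ 2 * geo N.+1]. *)
Lemma burke_row N m (phi : seq bool -> nat -> R) M :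
  (forall s h, size s = m -> `|phi s h| <= M) ->
  `|\sum_(h < N.+1) geo h * Ebits u m (fun Is => Ebits p m (fun ws =>
       phi (row_update h Is ws).1 (row_update h Is ws).2)) -
    \sum_(h < N.+1) geo h * Ebits u m (phi^~ h)| <= m%:R * (M *+ 2 * geo N.+1).
Proof.
elim: m phi => [|m IH] phi phiM; first by rewrite subrr normr0 mul0r.
pose psi b h := Ebits u m (fun Is => Ebits p m (fun ws =>
  phi (b :: (row_update h Is ws).1) (row_update h Is ws).2)).
have psiM b h : `|psi b h| <= M.
  apply: Ebits_norm_le => // s sm; apply: Ebits_norm_le => // t tm.
  by apply: phiM; rewrite /= size_row_update ?sm.
rewrite (eq_bigr (fun h : 'I_N.+1 => geo h *
  bern_avg u (fun b => bern_avg p (fun w => psi (corner_step b h w).1 (corner_step b h w).2)))); last first.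
  move=> h _; congr (_ * _); rewrite /bern_avg /psi.
  by congr (_ * _ + _ * _); rewrite -!EbitsZ -EbitsD; apply: eq_Ebits => s _.
rewrite burke_local.
rewrite [X in _ - X](eq_bigr (fun h : 'I_N.+1 => geo h *
  bern_avg u (fun b => Ebits u m (fun Is => phi (b :: Is) h))))//.
pose D b := \sum_(h < N.+1) geo h * psi b h -
  \sum_(h < N.+1) geo h * Ebits u m (fun Is => phi (b :: Is) h).
have DM b : `|D b| <= m%:R * (M *+ 2 * geo N.+1).
  by apply: (IH (fun Is h => phi (b :: Is) h)) => s h sm; apply: phiM; rewrite /= sm.
rewrite [X in `|X|](_ : _ = bern_avg u D +
  u * (1 - p) * geo N.+1 * (psi true N.+1 - psi false N)); last first.
  rewrite addrAC; congr (_ + _).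
  have avE (F : bool -> nat -> R) : \sum_(h < N.+1) geo h * bern_avg u (F^~ h) =
    u * (\sum_(h < N.+1) geo h * F true h) +
    (1 - u) * (\sum_(h < N.+1) geo h * F false h).
    rewrite !mulr_sumr -big_split/=; apply: eq_bigr => h _; rewrite /bern_avg; ring.
  by rewrite avE (avE (fun b h => Ebits u m (fun Is => phi (b :: Is) h))) /bern_avg /D; ring.
apply: (le_trans (ler_normD _ _)); rewrite -natr1 mulrDl mul1r lerD//.
  exact: bern_avg_norm_le.
have g0 := geo_ge0 N.+1.
have uu : 0 <= u * (1 - p) <= 1.
  case/andP: u01w => u0 u1; case/andP: p01w => p0 p1.
  by rewrite mulr_ge0 ?subr_ge0// mulr_ile1 ?subr_ge0// gerBl.
case/andP: uu => uu0 uu1.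
rewrite normrM (ger0_norm (mulr_ge0 uu0 g0)) mulrC; apply: ler_pM => //.
- exact: mulr_ge0.
- by rewrite (le_trans (ler_normB _ _))// mulr2n lerD.
- by rewrite ler_piMl.
Qed.

Fixpoint Egeo N n (f : seq nat -> R) : R :=
  if n is n'.+1 then \sum_(h < N) geo h * Egeo N n' (f \o cons (h : nat)) else f [::].

Lemma eq_Egeo N n f g : (forall s, size s = n -> f s = g s) -> Egeo N n f = Egeo N n g.
Proof.
elim: n f g => [|n IH] f g h /=; first exact: h.
by apply: eq_bigr => i _; congr (_ * _); apply: IH => s sn; apply: h; rewrite /= sn.
Qed.

Lemma Egeo_le N n f g : (forall s, size s = n -> f s <= g s) -> Egeo N n f <= Egeo N n g.
Proof.
elim: n f g => [|n IH] f g h /=; first exact: h.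
apply: ler_sum => i _; apply: ler_wpM2l; first exact: geo_ge0.
by apply: IH => s sn; apply: h; rewrite /= sn.
Qed.

Lemma EgeoZ N n c f : Egeo N n (fun s => c * f s) = c * Egeo N n f.
Proof.
elim: n f => [//|n IH] f /=; rewrite mulr_sumr; apply: eq_bigr => i _.
by rewrite IH; ring.
Qed.

Lemma EgeoD N n f g : Egeo N n (fun s => f s + g s) = Egeo N n f + Egeo N n g.
Proof.
elim: n f g => [//|n IH] f g /=; rewrite -big_split; apply: eq_bigr => i _ /=.
by rewrite IH; ring.
Qed.

Lemma Egeo_cst N n c : Egeo N n (fun=> c) = mass N ^+ n * c.
Proof.
elim: n => [|n IH]/=; first by rewrite expr0 mul1r.
rewrite exprS -mulrA -IH mulr_suml; exact: eq_bigr.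
Qed.

Lemma Egeo_sum N n k (F : nat -> seq nat -> R) :
  Egeo N n (fun s => \sum_(i < k) F i s) = \sum_(i < k) Egeo N n (F i).
Proof.
elim: k => [|k IH].
  rewrite big_ord0 -[RHS](mulr0 (mass N ^+ n)) -Egeo_cst.
  by apply: eq_Egeo => s _; rewrite big_ord0.
rewrite big_ord_recr/= -IH -EgeoD; apply: eq_Egeo => s _.
by rewrite big_ord_recr.
Qed.

Lemma Ebits_Egeo_exchange a m N n (F : seq bool -> seq nat -> R) :
  Ebits a m (fun s => Egeo N n (F s)) = Egeo N n (fun hs => Ebits a m (F^~ hs)).
Proof.
elim: n F => [//|n IH] F /=.
rewrite (Ebits_sum a m N (fun h s => geo h * Egeo N n (F s \o cons h))).
by apply: eq_bigr => h _; rewrite EbitsZ IH.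
Qed.

Lemma Egeo_norm_le N n f M : 0 <= M -> (forall s, size s = n -> `|f s| <= M) ->
  `|Egeo N n f| <= M.
Proof.
move=> M0 h; have := h; have := mass_ge0 N; have := mass_le1 N => m1 m0 h'.
apply: (@le_trans _ _ (mass N ^+ n * M)); last first.
  by rewrite ler_piMl// exprn_ile1.
rewrite ler_norml -mulrN -!Egeo_cst; apply/andP.
by split; apply: Egeo_le => s /h; rewrite ler_norml => /andP[].
Qed.

(** The horizontal increments on top of [n] rows have the law of those on the
    bottom: each row has its own vertical increment on the left, so [burke_row]
    applies to one row after the other. *)
Lemma burke N m n (f : seq bool -> R) M : 0 <= M ->
  (forall s, size s = m -> `|f s| <= M) ->
  `|Ebits u m (fun Is => Egeo N.+1 n (fun hs => Erows p m n (fun rs => f (run_rows Is hs rs)))) -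
    mass N.+1 ^+ n * Ebits u m f| <= n%:R * (m%:R * (M *+ 2 * geo N.+1)).
Proof.
move=> M0 fM; elim: n => [|n IH] /=.
  by rewrite expr0 mul1r subrr normr0 mul0r.
pose F Is := Egeo N.+1 n (fun hs => Erows p m n (fun rs => f (run_rows Is hs rs))).
have FM Is : size Is = m -> `|F Is| <= M.
  move=> Im; apply: Egeo_norm_le => // hs hn.
  rewrite ler_norml -[- M](Erows_cst p m n) -[X in _ && (_ <= X)](Erows_cst p m n).
  have runM rs : size rs = n -> all (fun r => size r == m) rs ->
      `|f (run_rows Is hs rs)| <= M.
    move=> rn rm; apply: fM; elim: hs rs Is Im n rn {hn} rm {IH F} => [//|h hs IHh].
    move=> [//|r rs] Is Im n' [rn] /= /andP[/eqP rm rsm].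
    by apply: IHh rsm => //; rewrite size_row_update// Im.
  apply/andP; split; apply: Erows_le => // rs rn rm;
    by have := runM rs rn rm; rewrite ler_norml => /andP[].
set X := Ebits _ _ _.
have -> : X = \sum_(h < N.+1) geo h * Ebits u m (fun Is => Ebits p m (fun ws =>
    F (row_update h Is ws).1)).
  rewrite /X (Ebits_sum u m N.+1 (fun h Is => geo h * Egeo N.+1 n
    ((fun hs => Ebits p m (fun r => Erows p m n ((fun rs => f (run_rows Is hs rs)) \o cons r)))
      \o cons h))).
  apply: eq_bigr => h _; rewrite EbitsZ; congr (_ * _); apply: eq_Ebits => Is _ /=.
  by rewrite -Ebits_Egeo_exchange.
have := burke_row (phi := fun s _ => F s) N (fun s h => FM s).
set Y := \sum_(h < N.+1) _; set Y' := \sum_(h < N.+1) _ => hY.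
have Y'E : Y' = mass N.+1 * Ebits u m F by rewrite /Y' -mulr_suml.
rewrite [X in `|X|](_ : _ = (Y - Y') + mass N.+1 * (Ebits u m F - mass N.+1 ^+ n * Ebits u m f)); last by rewrite Y'E exprS; ring.
apply: (le_trans (ler_normD _ _)); rewrite -[in leRHS]addn1 natrD mulrDl mul1r addrC.
rewrite lerD// normrM ger0_norm ?mass_ge0//.
by apply: le_trans IH; rewrite ler_piMl// mass_le1.
Qed.

End Burke.

(** * Bounds on the moment generating function *)

Lemma prefix_countS s i : (i < size s)%N -> prefix_count s i.+1 = (prefix_count s i + nth false s i)%N.
Proof.
by move=> h; rewrite /prefix_count (take_nth false)// -cats1 count_cat /= addn0.
Qed.

(** Used to let the truncation level tend to infinity: the cut sums differ from
    the full ones by factors [1 - r1 ^+ N.+1] and errors [C * r2 ^+ N.+1]. *)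
Lemma le_of_geometric_error {R : realType} (r1 r2 : R) k (A B C : R) :
  0 <= r1 < 1 -> 0 <= r2 < 1 ->
  (forall N, A * (1 - r1 ^+ N.+1) ^+ k <= B + C * r2 ^+ N.+1) -> A <= B.
Proof.
move=> /andP[r10 r11] /andP[r20 r21] h.
have c (r : R) : 0 <= r -> r < 1 -> r ^+ N.+1 @[N --> \oo] --> (0 : R).
  move=> r_0 r_1; have := @cvg_expr R r; rewrite ger0_norm// => /(_ r_1).
  by rewrite -(cvg_shiftS (fun n => r ^+ n)).
have cl : A * (1 - r1 ^+ N.+1) ^+ k @[N --> \oo] --> A * (1 - 0) ^+ k.
  apply: cvgMl_tmp; apply: (@cvg_comp _ _ _ (fun N => 1 - r1 ^+ N.+1)
    (fun z : R => z ^+ k) _ (nbhs (1 - 0 : R))); last exact: exprn_continuous.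
  by apply: cvgB; [exact: cvg_cst|exact: c].
have cr : B + C * r2 ^+ N.+1 @[N --> \oo] --> B + C * 0.
  by apply: cvgD; [exact: cvg_cst|apply: cvgMl_tmp; exact: c].
have := ler_cvg_to cl cr (nearW _ h).
by rewrite subr0 expr1n mulr1 mulr0 addr0; apply.
Qed.

Section GeneratingFunction.
Context {R : realType} (p x : R).
Hypotheses (p01 : 0 < p < 1) (x1 : 1 <= x).

Let p01w : 0 <= p <= 1. Proof. by case/andP: p01 => ? ?; rewrite !ltW. Qed.
Let x0 : 0 < x. Proof. exact: lt_le_trans x1. Qed.

Lemma mgf_drop_cols k m n : (k <= m)%N ->
  Erows p m n.+1 (fun rs => x ^+ lpp (shift k 0 (config_of_rows rs)) (m - k) n) = mgf p x (m - k) n.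
Proof.
move=> km; rewrite /mgf -(Erows_drop_cols p k (m - k) n.+1
  (fun rs => x ^+ lpp (config_of_rows rs) (m - k) n)) subnKC//.
apply: eq_Erows => rs rn _ /=; congr (_ ^+ _); apply: eq_lpp => i j im jn.
rewrite /shift /config_of_rows (nth_map [::]) ?rn// nth_drop//.
Qed.

Lemma mgf_drop_rows l m n : (l <= n)%N ->
  Erows p m n.+1 (fun rs => x ^+ lpp (shift 0 l (config_of_rows rs)) m (n - l)) = mgf p x m (n - l).
Proof.
move=> ln; rewrite /mgf -(Erows_drop_rows p m l (n - l).+1
  (fun rs => x ^+ lpp (config_of_rows rs) m (n - l))) addnS subnKC//.
apply: eq_Erows => rs rn _ /=; congr (_ ^+ _); apply: eq_lpp => i j im jn.
by rewrite /shift /config_of_rows nth_drop.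
Qed.

Lemma mgf_ge0 m n : 0 <= mgf p x m n.
Proof.
by rewrite -(Erows_cst p m n.+1 0); apply: Erows_le => // rs _ _; rewrite exprn_ge0// ltW.
Qed.

Lemma mgf_le_cols k m n : (k <= m)%N -> mgf p x (m - k) n <= mgf p x m n.
Proof.
move=> km; rewrite -mgf_drop_cols//; apply: Erows_le => // rs _ _.
rewrite ler_weXn2l//; have := lpp_superadd (config_of_rows rs) k 0 (m - k) n.
by rewrite subnKC// add0n; apply: leq_trans; rewrite leq_addl.
Qed.

Lemma mgf_le_rows l m n : (l <= n)%N -> mgf p x m (n - l) <= mgf p x m n.
Proof.
move=> ln; rewrite -mgf_drop_rows//; apply: Erows_le => // rs _ _.
rewrite ler_weXn2l//; have := lpp_superadd (config_of_rows rs) 0 l m (n - l).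
by rewrite subnKC.
Qed.

Lemma Ebits_count a m (z : R) :
  Ebits a m (fun s => z ^+ count id s) = (1 - a + a * z) ^+ m.
Proof.
elim: m => [//|m IH]; set F := fun s : seq bool => z ^+ count id s.
transitivity (a * (z * Ebits a m F) + (1 - a) * Ebits a m F).
  by congr (_ + _); congr (_ * _); rewrite -?EbitsZ; apply: eq_Ebits => s _; rewrite /F /= ?exprS.
by rewrite IH exprS; ring.
Qed.

Lemma Ebits_prefix_count a m k (z : R) : (k <= m)%N ->
  Ebits a m (fun s => z ^+ prefix_count s k) = (1 - a + a * z) ^+ k.
Proof.
move=> km; rewrite -(subnKC km) Ebits_cat -(Ebits_count a k).
apply: eq_Ebits => s sk; rewrite -[RHS](Ebits_cst a (m - k)); apply: eq_Ebits => t _.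
by rewrite /prefix_count take_size_cat.
Qed.

Lemma mgf_row0 m : mgf p x m 0 = (1 - p + p * x) ^+ m.
Proof.
rewrite -(Ebits_count p m); rewrite /mgf /=; apply: eq_Ebits => s sm; congr (_ ^+ _).
suff h i : (i <= m)%N -> lpp (config_of_rows [:: s]) i 0 = prefix_count s i.
  by rewrite h// /prefix_count take_oversize// sm.
elim: i => [|i IH] im; first by rewrite /prefix_count take0.
by rewrite lppS0 IH ?(ltnW im)// prefix_countS// sm.
Qed.

Section Stationary.
Context (u q : R).
Hypotheses (pu1 : p < u <= 1) (q01 : 0 < q <= 1).
Hypothesis qE : u * (1 - p) * (1 - q) = (1 - u) * p.

Let y := x^-1.
Let y01 : 0 < y <= 1.
Proof. by rewrite /y invr_gt0 x0 invf_le1. Qed.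
Let b := 1 - u + u * x.
Let g := q / (1 - y * (1 - q)).
Let gN N := \sum_(h < N) geo q h * y ^+ h.

Let u01w : 0 <= u <= 1.
Proof. by case/andP: pu1 => pu ->; case/andP: p01 => p0 _; rewrite ltW// (lt_trans p0). Qed.

Let yq : 0 <= y * (1 - q) < 1.
Proof.
case/andP: y01 => y0 y1; case/andP: q01 => q0 q1.
apply/andP; split; first by rewrite mulr_ge0 ?subr_ge0 ?(ltW y0).
by apply: (@le_lt_trans _ _ (1 - q)); rewrite ?ler_piMl ?subr_ge0// gtrBl.
Qed.

Let den_gt0 : 0 < 1 - y * (1 - q).
Proof. by rewrite subr_gt0; case/andP: yq. Qed.

Let gN_ge0 N : 0 <= gN N.
Proof.
apply: sumr_ge0 => i _; rewrite mulr_ge0 ?geo_ge0// exprn_ge0// ltW//.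
by case/andP: y01.
Qed.

Let gNE N : gN N = g * (1 - (y * (1 - q)) ^+ N).
Proof.
rewrite /gN geo_sum; first by rewrite /g; field; rewrite gt_eqF.
by case/andP: yq => _ h; rewrite lt_eqF.
Qed.

Let g_ge0 : 0 <= g.
Proof. by rewrite divr_ge0// ltW//; case/andP: q01. Qed.

Let gN_le N : gN N <= g.
Proof.
by rewrite gNE ler_piMr// gerBl exprn_ge0//; case/andP: yq.
Qed.

Let runE m Is hs rs : size Is = m -> size hs = size rs ->
  all (fun r => size r == m) rs ->
  x ^+ count id (run_rows Is hs rs) = y ^+ sumn hs *
  x ^+ lpp_bd (prefix_count Is) (fun j => sumn (take j hs)) (config_of_rows rs) m (size rs).
Proof.
move=> Im hr rm; rewrite (lpp_bd_run Im hr rm) exprD mulrA -exprMn /y.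
by rewrite mulVf ?gt_eqF// expr1n mul1r.
Qed.

(** Up to an error that vanishes with [N], the total increment along the top of
    [n] rows is binomial. *)
Let run_law N m n :
  `|Ebits u m (fun Is => Egeo q N.+1 n (fun hs => Erows p m n
      (fun rs => x ^+ count id (run_rows Is hs rs)))) - mass q N.+1 ^+ n * b ^+ m| <=
  n%:R * (m%:R * (x ^+ m *+ 2 * q)) * (1 - q) ^+ N.+1.
Proof.
have M0 : 0 <= x ^+ m by rewrite exprn_ge0// ltW.
have fM (s : seq bool) : size s = m -> `|x ^+ count id s| <= x ^+ m.
  by move=> sm; rewrite ger0_norm ?exprn_ge0 ?(ltW x0)// ler_weXn2l// -sm count_size.
have := burke p01 pu1 q01 qE N n M0 fM.
by rewrite Ebits_count /geo !mulrA.
Qed.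

Let q1_01 : 0 <= 1 - q < 1.
Proof. by case/andP: q01 => q0 q1; rewrite subr_ge0 q1 gtrBl. Qed.

Let b_ge0 : 0 <= b.
Proof.
by case/andP: u01w => u0 u1; rewrite addr_ge0 ?subr_ge0// mulr_ge0// ltW.
Qed.

Let Egeo_sumn N n : Egeo q N n (fun hs => y ^+ sumn hs) = gN N ^+ n.
Proof.
elim: n => [//|n IH] /=; rewrite exprS -IH {1}/gN mulr_suml.
apply: eq_bigr => h _; rewrite -mulrA -[in RHS]EgeoZ; congr (_ * _).
by apply: eq_Egeo => s _ /=; rewrite exprD.
Qed.

Let Egeo_sumn_drop N n l : (l <= n)%N ->
  Egeo q N n (fun hs => y ^+ sumn (drop l hs)) = mass q N ^+ l * gN N ^+ (n - l).
Proof.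
elim: l n => [|l IH] n ln.
  by rewrite mul1r subn0 -Egeo_sumn; apply: eq_Egeo => s _; rewrite drop0.
case: n ln => [//|n] ln /=; rewrite subSS exprS -mulrA -(IH n)// [X in X * _]/mass.
by rewrite mulr_suml; apply: eq_bigr => h _; congr (_ * _); apply: eq_Egeo.
Qed.

(** The boundary value dominates the bulk value, so the increments along the top
    are at least the bulk value minus the sum of the geometric variables on the
    left, which is independent of the bulk.  Here [g] is the generating function
    of a geometric variable at [x^-1]. *)
Lemma mgf_le_stationary m n : mgf p x m n * g ^+ n.+1 <= b ^+ m.
Proof.
apply: (@le_of_geometric_error _ (y * (1 - q)) (1 - q) n.+1 _ _
  (n.+1%:R * (m%:R * (x ^+ m *+ 2 * q)))) => // N.
have := run_law N m n.+1.
set X := Ebits _ _ _ => /ler_normlW; rewrite lerBlDl => h.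
rewrite -mulrA -exprMn -gNE.
apply: (@le_trans _ _ X); last first.
  apply: (le_trans h); rewrite lerD2r ler_piMl ?exprn_ge0// exprn_ile1//.
    exact: mass_ge0.
  exact: mass_le1.
rewrite /X -[leLHS](Ebits_cst u m); apply: Ebits_le => // Is Im.
rewrite -Egeo_sumn -EgeoZ; apply: Egeo_le => // hs hn.
rewrite mulrC -ErowsZ; apply: Erows_le => // rs rn rm.
rewrite (runE Im)// ?hn// ler_wpM2l//.
  by rewrite exprn_ge0// ltW//; case/andP: y01.
by rewrite ler_weXn2l// rn; apply: lpp_le_lpp_bd.
Qed.

(** The converse bound sums over the exit points.  Given an exit on the bottom
    at [k], all [n.+1] vertical increments are subtracted and [k] horizontal ones
    are collected; given an exit on the left after [l.+1] vertical steps, only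
    the [n - l] remaining vertical increments are subtracted. *)
Lemma stationary_le_mgf m n :
  b ^+ m <= \sum_(k < m.+1) g ^+ n.+1 * b ^+ k * mgf p x (m - k) n +
            \sum_(l < n.+1) g ^+ (n - l) * mgf p x m (n - l).
Proof.
apply: (@le_of_geometric_error _ (1 - q) (1 - q) n.+1 _ _
  (n.+1%:R * (m%:R * (x ^+ m *+ 2 * q)))) => // N.
have := run_law N m n.+1.
set X := Ebits _ _ _; rewrite distrC => /ler_normlW; rewrite lerBlDl => h.
rewrite -massE mulrC; apply: (le_trans h); rewrite lerD2r.
(* the contributions of the bottom exits [E] and of the left exits [E'] *)
pose E k Is hs rs : R := y ^+ sumn hs * (x ^+ prefix_count Is k *
    x ^+ lpp (shift k 0 (config_of_rows rs)) (m - k) n).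
pose E' l hs rs : R := y ^+ sumn (drop l.+1 hs) *
    x ^+ lpp (shift 0 l (config_of_rows rs)) m (n - l).
apply: (@le_trans _ _ (Ebits u m (fun Is => Egeo q N.+1 n.+1 (fun hs => Erows p m n.+1
   (fun rs => \sum_(k < m.+1) E k Is hs rs + \sum_(l < n.+1) E' l hs rs))))).
  apply: Ebits_le => // Is Im; apply: Egeo_le => // hs hn; apply: Erows_le => // rs rn rm.
  have E0 k : 0 <= E k Is hs rs.
    by rewrite /E !mulr_ge0// exprn_ge0// ltW//; case/andP: y01.
  have E'0 l : 0 <= E' l hs rs.
    by rewrite /E' !mulr_ge0// exprn_ge0// ltW//; case/andP: y01.
  rewrite (runE Im)// ?hn// rn.
  have [[k km hk]|[l ln hl]] := lpp_bd_exit (prefix_count Is) (fun j => sumn (take j hs)) (config_of_rows rs) m n.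
    rewrite -ltnS in km.
    rewrite (bigD1 (Ordinal km))//= -addrA; apply: ler_wpDr.
      by rewrite addr_ge0// sumr_ge0.
    rewrite /E -exprD ler_wpM2l ?ler_weXn2l// exprn_ge0// ltW//; by case/andP: y01.
  rewrite -ltnS in ln.
  rewrite [X in _ + X](bigD1 (Ordinal ln))//= addrCA; apply: ler_wpDr.
    by rewrite addr_ge0// sumr_ge0.
  rewrite /E' -[X in y ^+ sumn X](cat_take_drop l.+1 hs) sumn_cat exprD.
  rewrite [X in X * _]mulrC -mulrA ler_wpM2l//.
    by rewrite exprn_ge0// ltW//; case/andP: y01.
  apply: (le_trans (ler_wpM2l _ (ler_weXn2l x1 hl))).
    by rewrite exprn_ge0// ltW//; case/andP: y01.
  by rewrite exprD mulrA -exprMn /y mulVf ?gt_eqF// expr1n mul1r.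
rewrite (eq_Ebits _ (g := fun Is => \sum_(k < m.+1)
     gN N.+1 ^+ n.+1 * x ^+ prefix_count Is k * mgf p x (m - k) n +
   \sum_(l < n.+1) mass q N.+1 ^+ l.+1 * gN N.+1 ^+ (n - l) * mgf p x m (n - l))); last first.
  move=> Is Im.
  rewrite (eq_Egeo q N.+1 (g := fun hs => \sum_(k < m.+1)
     y ^+ sumn hs * (x ^+ prefix_count Is k * mgf p x (m - k) n) +
   \sum_(l < n.+1) y ^+ sumn (drop l.+1 hs) * mgf p x m (n - l))); last first.
    move=> hs hn; rewrite ErowsD.
    rewrite (Erows_sum p m n.+1 m.+1 (fun k => E k Is hs)).
    rewrite (Erows_sum p m n.+1 n.+1 (fun l => E' l hs)).
    congr (_ + _); apply: eq_bigr => k _; rewrite !ErowsZ.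
      by rewrite mgf_drop_cols// -ltnS.
    by rewrite mgf_drop_rows// -ltnS.
  rewrite EgeoD.
  rewrite (Egeo_sum q N.+1 n.+1 m.+1 (fun k hs =>
     y ^+ sumn hs * (x ^+ prefix_count Is k * mgf p x (m - k) n))).
  rewrite (Egeo_sum q N.+1 n.+1 n.+1 (fun l hs =>
     y ^+ sumn (drop l.+1 hs) * mgf p x m (n - l))).
  congr (_ + _); apply: eq_bigr => k _.
    rewrite -Egeo_sumn -mulrA [RHS]mulrC -EgeoZ.
    by apply: eq_Egeo => s _; rewrite mulrC.
  rewrite -subSS -Egeo_sumn_drop// [RHS]mulrC -EgeoZ.
  by apply: eq_Egeo => s _; rewrite mulrC.
rewrite EbitsD Ebits_cst (Ebits_sum u m m.+1 (fun k Is =>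
   gN N.+1 ^+ n.+1 * x ^+ prefix_count Is k * mgf p x (m - k) n)).
have gXle k : gN N.+1 ^+ k <= g ^+ k by apply: lerXn2r; rewrite ?nnegrE.
apply: lerD; apply: ler_sum => k _.
  rewrite EbitsZr EbitsZ Ebits_prefix_count -1?ltnS// -/b.
  by rewrite ler_wpM2r ?mgf_ge0// ler_wpM2r ?exprn_ge0.
rewrite ler_wpM2r ?mgf_ge0//; apply: le_trans (gXle (n - k)%N).
by rewrite ler_piMl ?exprn_ge0// exprn_ile1 ?mass_ge0 ?mass_le1.
Qed.

End Stationary.
End GeneratingFunction.

(** * Fekete's lemma and the rate function *)

Section Fekete.
Context {R : realType}.

(** The rate [J] is the infimum of [- ln (l N) / N] over the [N > 0] with
    [l N > 0], which explains why the first bound holds for every [N] without correction.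
    For the second, write [N = k * M + r] with a nearly optimal [M] and [r] in a
    window of length [M] above [N0], where [l] is positive. *)
Lemma fekete (l : nat -> R) N0 :
  (forall N, 0 <= l N <= 1) -> (forall N M, l N * l M <= l (N + M)%N) ->
  (forall N, (N0 <= N)%N -> 0 < l N) ->
  exists2 J : R, forall N, l N <= expR (- (N%:R * J)) &
    forall e, 0 < e -> exists N1, forall N, (N1 <= N)%N ->
      0 < l N /\ expR (- (N%:R * (J + e))) <= l N.
Proof.
move=> l01 lM lpos.
have lnl0 N : ln (l N) <= 0 by apply: ln_le0; case/andP: (l01 N).
pose S := [set - ln (l N) / N%:R | N in [set N | (0 < N)%N && (0 < l N)]].
have SlbP : lbound S 0.
  by move=> _ [N /andP[N0' lN]] <-; rewrite divr_ge0// oppr_ge0.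
have hS : has_inf S.
  split; last by exists 0.
  by exists (- ln (l N0.+1) / N0.+1%:R), N0.+1 => //=; rewrite lpos.
exists (inf S).
  move=> N; case: (posnP N) => [->|N_gt0].
    by rewrite mul0r oppr0 expR0; case/andP: (l01 0%N).
  case/andP: (l01 N); rewrite le_eqVlt => /orP[/eqP <- _|lN _].
    exact: expR_ge0.
  rewrite -[leLHS](lnK lN) ler_expR lerNr mulrC -ler_pdivlMr ?ltr0n//.
  by apply: ge_inf; [exact: hS.2|exists N => //=; rewrite N_gt0].
move=> e e0.
have e20 : 0 < e / 2 by rewrite divr_gt0.
have [_ [M /andP[M0 lM0] <-] hM] := inf_adherent e20 hS.
set J := inf S in hM *.
pose C := \sum_(i < N0 + M) (- ln (l i)).
have C0 : 0 <= C by apply: sumr_ge0 => i _; rewrite oppr_ge0.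
have lMkr k r : l M ^+ k * l r <= l (k * M + r)%N.
  elim: k => [|k IH]; first by rewrite mul1r.
  rewrite exprS -mulrA mulSn -addnA; apply: le_trans (lM _ _).
  by rewrite ler_wpM2l// ltW.
exists (maxn N0 (Num.truncn (C / (e / 2))).+1) => N; rewrite geq_max => /andP[N0N hN].
have lN := lpos _ N0N; split=> //.
rewrite -[leRHS](lnK lN) ler_expR lerNl.
pose r := (N0 + (N - N0) %% M)%N; pose k := ((N - N0) %/ M)%N.
have Nkr : N = (k * M + r)%N.
  by rewrite /k /r addnCA -divn_eq subnKC.
have lr : 0 < l r by apply: lpos; rewrite leq_addr.
have rlt : (r < N0 + M)%N by rewrite ltn_add2l ltn_mod.
have lnr : - ln (l r) <= C.
  rewrite /C (bigD1 (Ordinal rlt))//= lerDl.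
  by apply: sumr_ge0 => i _; rewrite oppr_ge0.
have h1 : - ln (l N) <= k%:R * (- ln (l M)) + C.
  apply: (@le_trans _ _ (- ln (l M ^+ k * l r))).
    by rewrite lerN2 Nkr ler_ln ?posrE ?mulr_gt0 ?exprn_gt0// -?Nkr.
  rewrite lnM ?posrE ?exprn_gt0// lnXn// -[ln (l M) *+ k]mulr_natl.
  by move: lnr; lra.
apply: (le_trans h1).
have h2 : C <= N%:R * (e / 2).
  rewrite -ler_pdivrMr//; apply: ltW; apply: lt_le_trans (truncnS_gt _) _.
  by rewrite ler_nat.
have h3 : k%:R * (- ln (l M)) <= N%:R * (J + e / 2).
  apply: (@le_trans _ _ (k%:R * (M%:R * (J + e / 2)))).
    rewrite ler_wpM2l//; rewrite mulrC -ler_pdivrMr ?ltr0n//.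
    exact: ltW.
  rewrite mulrA -natrM ler_wpM2r//.
    rewrite addr_ge0 ?(ltW e20)//; exact: lb_le_inf hS.1 SlbP.
  by rewrite ler_nat [leqRHS]Nkr leq_addr.
apply: (le_trans (lerD h3 h2)).
by rewrite -mulrDr -addrA -splitr.
Qed.
End Fekete.

Lemma truncn_superadd {R : realType} (a b : R) : 0 <= a -> 0 <= b ->
  (Num.truncn a + Num.truncn b <= Num.truncn (a + b))%N.
Proof.
move=> a0 b0; rewrite truncn_ge_nat ?addr_ge0// natrD lerD//.
  by rewrite truncn_le.
by rewrite truncn_le.
Qed.
Lemma midpoint_lt {R : realFieldType} (a b : R) :
  a < b -> a < (a + b) / 2 /\ (a + b) / 2 < b.
Proof. by move=> ab; split; lra. Qed.

Lemma scale_cost {R : realFieldType} m (s : R) :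
  m.+2%:R / m.+1%:R * (s + s / m.+2%:R) - s = 2 * (s / m.+1%:R).
Proof.
have : m.+2%:R != 0 :> R by rewrite pnatr_eq0.
have : m.+1%:R != 0 :> R by rewrite pnatr_eq0.
by rewrite -(natr1 m.+1); move: m.+1%:R => k k0 k10; field; rewrite k0 k10.
Qed.

Section RateFunction.
Context d (T : measurableType d) (R : realType) (P : probability T R) (p : R).
Variable omega : site -> {RV P >-> bool}.
Hypothesis p01 : 0 < p < 1.
Hypothesis iid : iid_bernoulli p omega.

Definition tail_seq (s t r : R) (N : nat) : R :=
  tail_prob p (Num.truncn (N%:R * s)) (Num.truncn (N%:R * t)) (N%:R * r).

(** The rate function inside its domain, as a real number; [rate_spec] shows that
    nothing is lost. *)
Definition rate (s t r : R) : R := fine (J_interior omega (s, t, r)).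

Let c0 : R := - ln p.

Let p0 : 0 < p. Proof. by case/andP: p01. Qed.

Let c0_gt0 : 0 < c0.
Proof. by rewrite /c0 oppr_gt0 ln_lt0. Qed.

Lemma tail_seq_superadd s t r s' t' r' N M : 0 <= s -> 0 <= t -> 0 <= s' -> 0 <= t' ->
  tail_seq s t r N * tail_seq s' t' r' M <=
  tail_prob p (Num.truncn (N%:R * s + M%:R * s')) (Num.truncn (N%:R * t + M%:R * t'))
    (N%:R * r + M%:R * r').
Proof.
move=> s0 t0 s'0 t'0; apply: le_trans (tail_prob_superadd p01 iid _ _ _ _ _ _) _.
by apply: (tail_prob_mono iid); rewrite ?truncn_superadd ?mulr_ge0.
Qed.

(** Set all weights of the bottom row to one.  Rounding [N * s] costs less than
    one, so level [N * r] is reached as soon as [1 <= N * (s - r)]. *)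
Lemma tail_seq_ge s t r N : 0 < s -> r < s -> (Num.truncn (s - r)^-1 < N)%N ->
  expR (- (N%:R * (c0 * s))) <= tail_seq s t r N.
Proof.
move=> s0 rs hN; set m := Num.truncn (N%:R * s).
have sr : 0 < s - r by rewrite subr_gt0.
have N1 : 1 <= N%:R * (s - r).
  rewrite -ler_pdivrMr// mul1r; apply: ltW; apply: lt_le_trans (truncnS_gt _) _.
  by rewrite ler_nat.
apply: le_trans (tail_prob_ge_pow iid (m := m) _ _); last first.
  have := truncnS_gt (N%:R * s); rewrite -/m -natr1 => h.
  move: N1; rewrite mulrBr; lra.
have -> : p ^+ m = expR (- (c0 * m%:R)).
  by rewrite /c0 mulNr opprK expRM_natr lnK ?posrE.
rewrite ler_expR lerN2 mulrCA ler_wpM2l ?(ltW c0_gt0)//.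
by rewrite truncn_le mulr_ge0// ltW.
Qed.

Lemma rate_spec s t r : 0 < s -> 0 < t -> r < s ->
  [/\ J_interior omega (s, t, r) = (rate s t r)%:E,
      forall N, tail_seq s t r N <= expR (- (N%:R * rate s t r)) &
      forall e, 0 < e -> exists N1, forall N, (N1 <= N)%N ->
        expR (- (N%:R * (rate s t r + e))) <= tail_seq s t r N].
Proof.
move=> s0 t0 rs.
have L01 N : 0 <= tail_seq s t r N <= 1.
  by apply/andP; split; [exact: tail_prob_ge0|exact: tail_prob_le1].
have LM N M : tail_seq s t r N * tail_seq s t r M <= tail_seq s t r (N + M)%N.
  have [s0' t0'] := (ltW s0, ltW t0).
  apply: (le_trans (tail_seq_superadd r r N M s0' t0' s0' t0')).
  by rewrite -!mulrDl -natrD.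
have Lpos N : ((Num.truncn (s - r)^-1).+1 <= N)%N -> 0 < tail_seq s t r N.
  by move=> hN; apply: lt_le_trans (tail_seq_ge t s0 rs hN); apply: expR_gt0.
have [J J1 J2] := fekete L01 LM Lpos.
suff JE : J_interior omega (s, t, r) = J%:E.
  by rewrite /rate JE/=; split=> // e /J2[N1 h]; exists N1 => N /h[].
have -> : J%:E = oppe (- J)%:E by rewrite /= opprK.
rewrite /J_interior; congr (oppe _).
apply: cvg_lim => //.
have E N : 0 < tail_seq s t r N ->
    log_tail omega s t r N = (N%:R^-1 * ln (tail_seq s t r N))%:E.
  move=> LN; rewrite /log_tail (G_law iid) -/(tail_seq s t r N) lne_EFin//.
apply: (@cvg_trans _ ((N%:R^-1 * ln (tail_seq s t r N))%:E @[N --> \oo])).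
  apply: near_eq_cvg; near=> N; rewrite E//; apply: Lpos.
  by near: N; exact: nbhs_infty_ge.
apply: cvg_EFin; first exact: nearW.
apply/cvgrPdist_le => e e0; have [N1 hN1] := J2 _ e0.
near=> N; have N0 : (0 < N)%N by near: N; exact: nbhs_infty_gt.
have [LN hN] : 0 < tail_seq s t r N /\ expR (- (N%:R * (J + e))) <= tail_seq s t r N.
  by apply: hN1; near: N; exact: nbhs_infty_ge.
have := J1 N; move: hN; rewrite -[tail_seq s t r N](lnK LN) !ler_expR.
have NR : 0 < N%:R :> R by rewrite ltr0n.
move=> h1 h2 /=.
have h1' : - (J + e) <= N%:R^-1 * ln (tail_seq s t r N).
  by rewrite -(ler_pM2l NR) mulVKf ?gt_eqF// mulrN.
have h2' : N%:R^-1 * ln (tail_seq s t r N) <= - J.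
  by rewrite -(ler_pM2l NR) mulVKf ?gt_eqF// mulrN.
rewrite ler_norml; lra.
Unshelve. all: by end_near. Qed.


Lemma le0_of_mulrn_bounded (a C : R) N1 :
  (forall N, (N1 <= N)%N -> N%:R * a <= C) -> a <= 0.
Proof.
move=> h; rewrite leNgt; apply/negP => a0.
have := h (maxn N1 (Num.truncn (C / a)).+1) (leq_maxl _ _).
rewrite -ler_pdivlMr// leNgt => /negP; apply.
by apply: lt_le_trans (truncnS_gt _) _; rewrite ler_nat leq_maxr.
Qed.

Section Interior.
Variables s t r : R.
Hypotheses (s0 : 0 < s) (t0 : 0 < t) (rs : r < s).

Lemma tail_seq_le_rate N : tail_seq s t r N <= expR (- (N%:R * rate s t r)).
Proof. by case: (rate_spec s0 t0 rs). Qed.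

Lemma J_interiorE : J_interior omega (s, t, r) = (rate s t r)%:E.
Proof. by case: (rate_spec s0 t0 rs). Qed.

(** This and [rate_le] compare the rate with an exponential bound on the tail
    probabilities, up to a constant factor and finitely many [N]. *)
Lemma rate_ge c C N0 :
  (forall N, (N0 <= N)%N -> tail_seq s t r N <= expR (C - N%:R * c)) -> c <= rate s t r.
Proof.
move=> h; apply/ler_addgt0Pr => e e0.
have [_ _ /(_ _ e0)[N1 h1]] := rate_spec s0 t0 rs.
rewrite -subr_le0; apply: (@le0_of_mulrn_bounded _ C (maxn N0 N1)) => N.
rewrite geq_max => /andP[/h hN /h1 h1N].
have := le_trans h1N hN; rewrite ler_expR mulrBr; lra.
Qed.

Lemma rate_le c C N0 :
  (forall N, (N0 <= N)%N -> expR (- C - N%:R * c) <= tail_seq s t r N) -> rate s t r <= c.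
Proof.
move=> h; rewrite -subr_le0; apply: (@le0_of_mulrn_bounded _ C N0) => N /h hN.
have := le_trans hN (tail_seq_le_rate N); rewrite ler_expR mulrBr; lra.
Qed.

Lemma rate_ge0 : 0 <= rate s t r.
Proof.
apply: (@rate_ge _ 0 0%N) => N _; rewrite mulr0 subr0 expR0; exact: tail_prob_le1.
Qed.

Lemma rate_le_cost : rate s t r <= c0 * s.
Proof.
apply: (@rate_le _ 0 (Num.truncn (s - r)^-1).+1) => N hN; rewrite oppr0 sub0r.
exact: tail_seq_ge.
Qed.
End Interior.

Lemma rate_mono s t r s' t' r' : 0 < s -> 0 < t -> s <= s' -> t <= t' ->
  r' <= r -> r < s -> rate s' t' r' <= rate s t r.
Proof.
move=> s0 t0 ss tt rr rs; apply: (@rate_ge _ _ _ s0 t0 rs _ 0 0%N) => N _.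
rewrite sub0r; apply: le_trans (tail_seq_le_rate _ _ _ N).
- by apply: (tail_prob_mono iid); rewrite ?le_truncn// ?ler_wpM2l.
- exact: lt_le_trans ss.
- exact: lt_le_trans tt.
- by apply: (le_lt_trans rr); apply: lt_le_trans ss.
Qed.

Lemma rate_subadd s t r s' t' r' : 0 < s -> 0 < t -> r < s ->
  0 < s' -> 0 < t' -> r' < s' ->
  rate (s + s') (t + t') (r + r') <= rate s t r + rate s' t' r'.
Proof.
move=> s0 t0 rs s0' t0' rs'; apply/ler_addgt0Pr => e e0.
have e20 : 0 < e / 2 by rewrite divr_gt0.
have [_ _ /(_ _ e20)[N1 h1]] := rate_spec s0 t0 rs.
have [_ _ /(_ _ e20)[N2 h2]] := rate_spec s0' t0' rs'.
apply: (@rate_le _ _ _ _ _ _ _ 0 (maxn N1 N2)); rewrite ?addr_gt0 ?ltrD// => N.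
rewrite geq_max => /andP[/h1 h1N /h2 h2N].
have := tail_seq_superadd r r' N N (ltW s0) (ltW t0) (ltW s0') (ltW t0').
rewrite -!mulrDr; apply: le_trans; apply: le_trans (ler_pM _ _ h1N h2N);
  rewrite ?expR_ge0// -expRD ler_expR !mulrDr; lra.
Qed.

Lemma rate_mulrn n s t r : (0 < n)%N -> 0 < s -> 0 < t -> r < s ->
  rate (n%:R * s) (n%:R * t) (n%:R * r) = n%:R * rate s t r.
Proof.
move=> n0 s0 t0 rs; have n0' : 0 < n%:R :> R by rewrite ltr0n.
have LE N : tail_seq (n%:R * s) (n%:R * t) (n%:R * r) N = tail_seq s t r (N * n).
  by rewrite /tail_seq !mulrA -!natrM.
have [ns nt nr] : [/\ 0 < n%:R * s, 0 < n%:R * t & n%:R * r < n%:R * s].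
  by rewrite !mulr_gt0 ?ltr_pM2l.
apply/eqP; rewrite eq_le; apply/andP; split; last first.
  apply: (@rate_ge _ _ _ ns nt nr _ 0 0%N) => N _; rewrite sub0r LE mulrA -natrM.
  exact: tail_seq_le_rate.
rewrite -ler_pdivrMl//; apply/ler_addgt0Pr => e e0.
rewrite ler_pdivrMl//.
have [_ _ /(_ _ e0)[N1 h1]] := rate_spec s0 t0 rs.
apply: (@rate_le _ _ _ ns nt nr _ 0 N1) => N N1N; rewrite oppr0 sub0r LE.
by rewrite mulrA -natrM h1// (leq_trans N1N)// leq_pmulr.
Qed.

(** The rate function is homogeneous of degree one.  Ratios of consecutive
    integers, which tend to one, are all that the continuity argument below needs. *)
Lemma rate_scale n s t r (lambda := n.+2%:R / n.+1%:R) : 0 < s -> 0 < t -> r < s ->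
  rate (lambda * s) (lambda * t) (lambda * r) = lambda * rate s t r.
Proof.
move=> s0 t0 rs; have n0 : 0 < n.+1%:R :> R by rewrite ltr0n.
have l0 : 0 < lambda by rewrite divr_gt0.
have := @rate_mulrn n.+1 (lambda * s) (lambda * t) (lambda * r) isT.
rewrite !mulr_gt0// ltr_pM2l// => /(_ isT isT rs).
have nl z : n.+1%:R * (lambda * z) = n.+2%:R * z.
  by rewrite /lambda; field; rewrite gt_eqF.
rewrite !nl rate_mulrn// -nl => /(mulfI _) <-//.
Qed.

Lemma ball_triple (a b : R * R * R) e : ball a e b ->
  [/\ `|a.1.1 - b.1.1| < e, `|a.1.2 - b.1.2| < e & `|a.2 - b.2| < e].
Proof. by case: a b => [[? ?] ?] [[? ?] ?] [[]]. Qed.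

(** Let [j] be the supremum of the rate over the points [(s, t', r')] with
    [t' > t] and [r' < r]; then the rate tends to [j] at [(s, t, r)].

    Lower bound: at a point [(s, t1, r1)] where the rate exceeds [j - e], scale by
    [la > 1] close to one.  This does not decrease the rate, and the scaled point
    has larger [s], larger [t] and smaller [r] than all points near [(s, t, r)].

    Upper bound: scale the nearby point [a] by [mu > 1] close to one.  In the
    coordinates [s], [t] and [s - r] the scaled point exceeds [(s, t, s - r)], so
    it is the sum of a point [(s, t', r')] with [t' > t] and [r' < r] and of a
    remainder whose first coordinate is small.  Subadditivity and [rate_le_cost]
    conclude. *)
Lemma J_interior_cvg s t r j : 0 < s -> 0 <= t -> r <= s ->
  (forall t' r', t < t' -> r' < r -> rate s t' r' <= j) ->
  (forall e, 0 < e -> exists t' r', [/\ t < t', r' < r & j - e < rate s t' r']) ->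
  J_interior omega a @[a --> within (interior_domain (R := R)) (nbhs (s, t, r))]
    --> j%:E.
Proof.
move=> s0 t0 rs ubj supj.
have scale_gt1 n : 1 < n.+2%:R / n.+1%:R :> R.
  by rewrite ltr_pdivlMr ?ltr0n// mul1r ltr_nat.
apply: (@cvg_trans _ ((rate a.1.1 a.1.2 a.2)%:E
    @[a --> within (interior_domain (R := R)) (nbhs (s, t, r))])).
  apply: near_eq_cvg; apply/nbhs_ballP; exists 1 => //= -[[a1 a2] a3] _ [h1 h2 h3].
  by rewrite J_interiorE.
apply: cvg_EFin; first by apply: nearW.
apply/cvgrPdist_le => e e0.
have [t1 [r1 [tt1 rr1 hj]]] := supj _ e0.
have : exists n, n.+2%:R / n.+1%:R * r1 < r.
  exists (Num.truncn (`|r1| / (r - r1))) => /=.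
  set k := Num.truncn _; have k0 : 0 < k.+1%:R :> R by rewrite ltr0n.
  have rr : 0 < r - r1 by rewrite subr_gt0.
  have : `|r1| < k.+1%:R * (r - r1) by rewrite -ltr_pdivrMr//; apply: truncnS_gt.
  move/(le_lt_trans (ler_norm _)) => h.
  rewrite mulrAC ltr_pdivrMr// -natr1; lra.
move=> [n hn]; pose la : R := n.+2%:R / n.+1%:R.
have la1 : 1 < la by apply: scale_gt1.
have : exists n, 2 * c0 * s / n.+1%:R <= e.
  exists (Num.truncn (2 * c0 * s / e)).
  rewrite ler_pdivrMr ?ltr0n// -ler_pdivrMl// mulrC; apply: ltW.
  exact: truncnS_gt.
move=> [m hm]; pose mu : R := m.+2%:R / m.+1%:R.
have mu1 : 1 < mu by apply: scale_gt1.
have mu0 : 0 < mu by apply: lt_trans mu1.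
have pos z : 0 <= z -> exists2 d0, 0 < d0 & forall z', 0 < z' -> `|z - z'| < d0 -> z < mu * z'.
  rewrite le_eqVlt => /orP[/eqP <-|z0].
    by exists 1 => // z' z'0 _; apply: mulr_gt0.
  exists (z - z / mu); first by rewrite subr_gt0 ltr_pdivrMr// ltr_pMr.
  move=> z' z'0; rewrite ltr_norml => /andP[_ h].
  by rewrite -ltr_pdivrMl// mulrC; lra.
have [d1 d10 hd1] := pos s (ltW s0).
have [d2 d20 hd2] := pos t t0.
have [d3 d30 hd3] : exists2 d0, 0 < d0 & forall z', 0 < z' ->
    `|(s - r) - z'| < d0 -> s - r < mu * z' by apply: pos; rewrite subr_ge0.
have las : 0 < la * s - s by rewrite subr_gt0 ltr_pMl.
pose d0 := Num.min (Num.min (Num.min d1 d2) (d3 / 2))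
  (Num.min (Num.min (t1 - t) (r - la * r1)) (Num.min (la * s - s) (s / m.+2%:R))).
apply/nbhs_ballP; exists d0 => /=.
  by rewrite !lt_min d10 d20 divr_gt0// !subr_gt0 tt1 hn -subr_gt0 las divr_gt0.
move=> [[a1 a2] a3] /ball_triple[/= b1 b2 b3] [a10 a20 a31] /=.
move: b1 b2 b3; rewrite !lt_min.
move=> /andP[/andP[/andP[b1 _] b1'] /andP[_ /andP[b1l b1m]]].
move=> /andP[/andP[/andP[_ b2] _] /andP[/andP[b2l _] _]].
move=> /andP[/andP[_ b3'] /andP[/andP[_ b3l] _]].
rewrite ler_norml; apply/andP; split.
  (* scaled point = (s, t', s - x') + remainder *)
  have mu_s := hd1 _ a10 b1; have mu_t := hd2 _ a20 b2.
  have mu_x : s - r < mu * (a1 - a3).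
    apply: hd3; first by rewrite subr_gt0.
    rewrite (_ : s - r - (a1 - a3) = (s - a1) - (r - a3)); last by ring.
    by apply: le_lt_trans (ler_normB _ _) _; move: b1' b3'; lra.
  pose t' := (t + mu * a2) / 2; pose x' := (s - r + mu * (a1 - a3)) / 2.
  have [tt' t'a] : t < t' /\ t' < mu * a2 by exact: midpoint_lt.
  have [xx' x'a] : s - r < x' /\ x' < mu * (a1 - a3) by exact: midpoint_lt.
  have r'r : s - x' < r by rewrite ltrBlDr -ltrBlDl.
  have := @rate_subadd s t' (s - x') (mu * a1 - s) (mu * a2 - t') (mu * a3 - (s - x')).
  have addKC (z w : R) : z + (w - z) = w by rewrite addrC subrK.
  rewrite !addKC !subr_gt0.
  move=> /(_ s0 (le_lt_trans t0 tt') (lt_le_trans r'r rs) mu_s t'a).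
  have rest : mu * a3 - (s - x') < mu * a1 - s by move: x'a; rewrite mulrBr; lra.
  move=> /(_ rest) hsub.
  have hmu := rate_scale m a10 a20 a31; rewrite -/mu in hmu.
  have hcost : rate (mu * a1 - s) (mu * a2 - t') (mu * a3 - (s - x')) <= c0 * (mu * a1 - s).
    by apply: rate_le_cost; rewrite ?subr_gt0.
  have hJ0 : 0 <= rate a1 a2 a3 by apply: rate_ge0.
  have hJmu : rate a1 a2 a3 <= mu * rate a1 a2 a3 by rewrite ler_peMl// ltW.
  have hj' := ubj _ _ tt' r'r.
  have hmul : c0 * (mu * a1 - s) <= e.
    apply: le_trans hm.
    rewrite [leRHS](_ : _ = c0 * (2 * (s / m.+1%:R))); last by ring.
    rewrite ler_wpM2l ?(ltW c0_gt0)//.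
    have m1 : 0 < m.+1%:R :> R by rewrite ltr0n.
    have m2 : 0 < m.+2%:R :> R by rewrite ltr0n.
    have a1s : a1 <= s + s / m.+2%:R.
      move: b1m; rewrite ltr_norml => /andP[h _].
      by rewrite -lerBlDl -lerN2 opprB ltW.
    apply: (@le_trans _ _ (mu * (s + s / m.+2%:R) - s)).
      by apply: lerB => //; apply: ler_wpM2l => //; exact: ltW.
    by rewrite /mu scale_cost.
  by rewrite hmu in hsub; lra.
have : rate (la * s) (la * t1) (la * r1) <= rate a1 a2 a3.
  move: b1l b2l b3l; rewrite !ltr_norml => /andP[h1 _] /andP[h2 _] /andP[_ h3].
  have t10 : 0 < t1 by apply: le_lt_trans tt1.
  have lt1 : t1 <= la * t1 by rewrite ler_peMl// ltW.
  apply: rate_mono => //; lra.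
rewrite rate_scale//; last 2 first.
- exact: le_lt_trans tt1.
- exact: lt_le_trans rr1 rs.
have : 0 <= rate s t1 r1.
  by apply: rate_ge0 => //; [exact: le_lt_trans tt1|exact: lt_le_trans rr1 rs].
move=> hpos; have : rate s t1 r1 <= la * rate s t1 r1 by rewrite ler_peMl// ltW.
rewrite -/la; lra.
Qed.

End RateFunction.

(** * Boundary values of the rate function *)

Section RateFunctionBoundary.
Context d (T : measurableType d) (R : realType) (P : probability T R) (p : R).
Variable omega : site -> {RV P >-> bool}.
Hypothesis p01 : 0 < p < 1.
Hypothesis iid : iid_bernoulli p omega.
Notation rate := (rate omega).
Notation tail_seq := (@tail_seq R p).
Let c0 : R := - ln p.
Let c0_gt0 : 0 < c0. Proof. by rewrite /c0 oppr_gt0 ln_lt0. Qed.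

Lemma proper_within_domain (s t r : R) : 0 <= s -> 0 <= t -> r <= s ->
  ProperFilter (within (interior_domain (R := R)) (nbhs (s, t, r))).
Proof.
move=> s0 t0 rs; apply: within_nbhs_proper => B /nbhs_ballP[e /= e0 hB].
have e20 : 0 < e / 2 by rewrite divr_gt0.
have e2e : e / 2 < e by rewrite ltr_pdivrMr// ltr_pMr// ltr1n.
exists (s + e / 2, t + e / 2, r); split.
  by rewrite /=; split; lra.
apply: hB; split => /=; last exact: ballxx.
by split; rewrite /ball /= opprD addNKr normrN gtr0_norm.
Qed.

(** The two properties of [J] that the computation of its dual uses, valid in
    the interior and on the boundary alike.  At a boundary point [J] is the
    supremum of the interior rates from above in [t] and from below in [r], and
    each of these bounds the tail probability at [(s, t, r)]. *)
Lemma J_bracket s t r : 0 < s -> 0 <= t -> r <= s ->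
  exists2 j, J omega s t r = j%:E &
    (forall t' r', t < t' -> r' < r -> rate s t' r' <= j) /\
    (forall N, tail_seq s t r N <= expR (- (N%:R * j))).
Proof.
move=> s0 t0 rs; rewrite /J s0 (ltW s0) t0 rs /=.
case: ifPn => [/andP[t_gt0 r_lts]|_].
  exists (rate s t r); first exact: (J_interiorE p01 iid).
  split; last by move=> N; apply: (tail_seq_le_rate p01 iid).
  by move=> t' r' tt' r'r; apply: (rate_mono p01 iid) => //; apply: ltW.
pose B : set R := [set z | exists t' r', [/\ t < t', r' < r & z = rate s t' r']].
have hB : has_sup B.
  split; first by exists (rate s (t + 1) (r - 1)), (t + 1), (r - 1); split=> //; lra.
  exists (c0 * s) => _ [t' [r' [tt' r'r ->]]].
  by apply: (rate_le_cost p01 iid) => //; [exact: le_lt_trans tt'|exact: lt_le_trans r'r rs].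
have ubB t' r' : t < t' -> r' < r -> rate s t' r' <= sup B.
  by move=> tt' r'r; apply: ub_le_sup; [exact: hB.2|exists t', r'].
exists (sup B).
  apply: cvg_lim => //; first exact: proper_within_domain (ltW s0) t0 rs.
  apply: (J_interior_cvg p01 iid) => // e e0.
  have [_ [t' [r' [tt' r'r ->]]] h] := sup_adherent e0 hB.
  by exists t', r'.
split=> // N; have := tail_prob_ge0 p01 (Num.truncn (N%:R * s)) (Num.truncn (N%:R * t)) (N%:R * r).
rewrite -/(tail_seq s t r N) le_eqVlt => /orP[/eqP <-|LN]; first exact: expR_ge0.
case: (posnP N) => [->|N0]; first by rewrite mul0r oppr0 expR0; apply: tail_prob_le1.
have N0' : 0 < N%:R :> R by rewrite ltr0n.
rewrite -[leLHS](lnK LN) ler_expR lerNr -ler_pdivlMl// mulrC.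
apply: sup_le_ub; first exact: hB.1.
move=> _ [t' [r' [tt' r'r ->]]]; rewrite ler_pdivlMr// mulrC lerNr.
rewrite -ler_expR lnK//.
apply: (@le_trans _ _ (tail_seq s t' r' N)).
  apply: (tail_prob_mono iid) => //; last by rewrite ler_wpM2l// ltW.
  by rewrite le_truncn// ler_wpM2l// ltW.
by apply: (tail_seq_le_rate p01 iid) => //; [exact: le_lt_trans tt'|exact: lt_le_trans r'r rs].
Qed.

(** Near [s = 0] the rate is squeezed between zero and the bound of
    [rate_le_cost], which is proportional to [s]. *)
Lemma J_left t r : 0 <= t -> r <= 0 -> J omega 0 t r = 0%E.
Proof.
move=> t0 r0; rewrite /J ltxx lexx t0 r0 /=.
apply: cvg_lim => //; first exact: proper_within_domain.
apply: (@cvg_trans _ ((rate a.1.1 a.1.2 a.2)%:E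
    @[a --> within (interior_domain (R := R)) (nbhs (0, t, r))])).
  apply: near_eq_cvg; apply/nbhs_ballP; exists 1 => //= -[[a1 a2] a3] _ [h1 h2 h3].
  by rewrite (J_interiorE p01 iid).
apply: cvg_EFin; first by apply: nearW.
apply/cvgrPdist_le => e e0; apply/nbhs_ballP; exists (e / c0) => /=.
  exact: divr_gt0.
move=> [[a1 a2] a3] /ball_triple[/= b1 _ _] [a10 a20 a31] /=.
move: b1; rewrite sub0r normrN gtr0_norm// ltr_pdivlMr// => b1.
rewrite sub0r normrN ger0_norm; last exact: (rate_ge0 p01 iid).
by apply: le_trans (rate_le_cost p01 iid a10 a20 a31) _; rewrite mulrC ltW.
Qed.

Lemma J_npos s t r : 0 <= s -> 0 <= t -> r <= 0 -> J omega s t r = 0%E.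
Proof.
rewrite le_eqVlt => /orP[/eqP <-|s0] t0 r0; first exact: J_left.
have [j -> [hU hL]] := J_bracket s0 t0 (le_trans r0 (ltW s0)).
congr (_%:E); apply/eqP; rewrite eq_le; apply/andP; split.
  have := hL 1%N; rewrite /tail_seq tail_prob_npos ?mul1r//.
  by rewrite -expR0 ler_expR oppr_ge0.
apply: le_trans (hU (t + 1) (r - 1) _ _); [|lra|lra].
by apply: (rate_ge0 p01 iid); lra.
Qed.

Lemma J_ge0 s t r : 0 <= s -> 0 <= t -> (0 <= J omega s t r)%E.
Proof.
rewrite le_eqVlt => /orP[/eqP <-|s0] t0.
  case: (leP r 0) => [r0|r0]; first by rewrite J_left.
  by rewrite /J ltxx /= lexx t0 (leNgt r) r0 /= le0y.
case: (leP r s) => [rs|rs]; last first.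
  by rewrite /J s0 (ltW s0) t0 (ltNge r) (ltW rs) (leNgt r) rs /= andbF le0y.
have [j -> [hU _]] := J_bracket s0 t0 rs; rewrite lee_fin.
apply: le_trans (hU (t + 1) (r - 1) _ _); [|lra|lra].
by apply: (rate_ge0 p01 iid); lra.
Qed.

Lemma J_out s t r : s < r -> J omega s t r = +oo%E.
Proof.
by move=> sr; rewrite /J (ltNge r) (ltW sr) (leNgt r) sr !andbF.
Qed.
End RateFunctionBoundary.

(** * The exponents of the stationary model *)

Section Exponents.
Context {R : realType} (p x : R).
Hypotheses (p01 : 0 < p < 1) (x1 : 1 < x).
Implicit Types u v s t : R.

(** The parameter for which Bernoulli([u]) and geometric increments are
    stationary. *)
Definition qparam u : R := (u - p) / (u * (1 - p)).
Definition bern_mgf u : R := 1 - u + u * x.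
(** The generating function at [x^-1] of a geometric([qparam u]) variable. *)
Definition geom_mgf u : R := qparam u / (1 - x^-1 * (1 - qparam u)).
Definition log_bern u : R := ln (bern_mgf u).
Definition geom_cost u : R := - ln (geom_mgf u).
Notation B := log_bern.
Notation D := geom_cost.

Let A : R := (1 - p) * x + p.
Let p0 : 0 < p. Proof. by case/andP: p01. Qed.
Let p1 : p < 1. Proof. by case/andP: p01. Qed.
Let x0 : 0 < x. Proof. exact: lt_trans x1. Qed.
Let A1 : 1 < A.
Proof.
rewrite /A -subr_gt0 (_ : _ - 1 = (1 - p) * (x - 1)); last by ring.
by rewrite mulr_gt0 ?subr_gt0.
Qed.

Lemma qparam_bounds u : p < u <= 1 -> 0 < qparam u <= 1.
Proof.
move=> /andP[pu u1]; have u0 : 0 < u by apply: lt_trans pu.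
have up0 : 0 < u * (1 - p) by rewrite mulr_gt0// subr_gt0.
rewrite /qparam divr_gt0 ?subr_gt0//= ler_pdivrMr// mul1r -subr_ge0.
rewrite (_ : _ - _ = p * (1 - u)); last by ring.
by rewrite mulr_ge0 ?(ltW p0)// subr_ge0.
Qed.

Lemma qparamE u : p < u <= 1 ->
  u * (1 - p) * (1 - qparam u) = (1 - u) * p.
Proof.
move=> /andP[pu u1]; have u0 : u != 0 by rewrite gt_eqF// (lt_trans p0).
have p1' : 1 - p != 0 by rewrite subr_eq0 gt_eqF.
by rewrite /qparam; field; rewrite u0 p1'.
Qed.

Lemma geom_num_gt0 u : p < u -> 0 < u * A - p.
Proof.
move=> pu; rewrite subr_gt0; apply: (lt_trans pu).
by rewrite ltr_pMr// (lt_trans p0).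
Qed.

(** In this form both the monotonicity and the derivative of the exponent are
    read off from a quotient of affine functions of [u]. *)
Lemma geom_mgfE u : p < u <= 1 -> geom_mgf u = x * (u - p) / (u * A - p).
Proof.
move=> pu1; have := geom_num_gt0 (proj1 (andP pu1)); move: (pu1) => /andP[pu u1] h.
have u0 : u != 0 by rewrite gt_eqF// (lt_trans p0).
have p1' : 1 - p != 0 by rewrite subr_eq0 gt_eqF.
have xn0 : x != 0 by rewrite gt_eqF.
have [q0 q1] := andP (qparam_bounds pu1).
have den : 1 - x^-1 * (1 - qparam u) = (u * A - p) / (x * (u * (1 - p))).
  rewrite /qparam /A; field; by rewrite u0 p1' xn0.
rewrite /geom_mgf den /qparam; field.
by rewrite u0 p1' gt_eqF//= !mulf_neq0.
Qed.

Lemma bern_mgf_gt0 u : 0 <= u <= 1 -> 0 < bern_mgf u.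
Proof.
move=> /andP[u0 u1]; rewrite /bern_mgf (_ : 1 - u + u * x = 1 + u * (x - 1)); last by ring.
by rewrite ltr_pwDl// mulr_ge0// subr_ge0 ltW.
Qed.

Lemma param_bounds u : p < u <= 1 -> 0 <= u <= 1.
Proof. by move=> /andP[pu ->]; rewrite ltW// (lt_trans p0). Qed.

Lemma geom_mgf_gt0 u : p < u <= 1 -> 0 < geom_mgf u.
Proof.
move=> pu1; rewrite geom_mgfE//; case/andP: pu1 => pu u1.
by rewrite divr_gt0 ?geom_num_gt0// mulr_gt0// subr_gt0.
Qed.

Lemma geom_mgf_le1 u : p < u <= 1 -> geom_mgf u <= 1.
Proof.
move=> pu1; rewrite geom_mgfE//; case/andP: pu1 => pu u1.
rewrite ler_pdivrMr ?geom_num_gt0// mul1r -subr_ge0.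
rewrite (_ : _ - _ = p * (1 - u) * (x - 1)); last by rewrite /A; ring.
by rewrite !mulr_ge0 ?subr_ge0// ltW.
Qed.

Lemma geom_mgf1 : geom_mgf 1 = 1.
Proof.
rewrite /geom_mgf (_ : qparam 1 = 1) ?subrr ?mulr0 ?subr0 ?divr1//.
by rewrite /qparam mul1r divff// subr_eq0 gt_eqF.
Qed.

Lemma geom_cost_ge0 u : p < u <= 1 -> 0 <= D u.
Proof. by move=> pu1; rewrite oppr_ge0 ln_le0// geom_mgf_le1. Qed.

Lemma geom_cost1 : D 1 = 0. Proof. by rewrite /geom_cost geom_mgf1 ln1 oppr0. Qed.

Lemma log_bern_ge0 u : 0 <= u <= 1 -> 0 <= B u.
Proof.
move=> /andP[u0 u1]; rewrite ln_ge0// /bern_mgf (_ : 1 - u + u * x = 1 + u * (x - 1)); last by ring.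
by rewrite lerDl mulr_ge0// subr_ge0 ltW.
Qed.

Lemma bern_mgf_expR u k : 0 <= u <= 1 -> bern_mgf u ^+ k = expR (k%:R * B u).
Proof.
by move=> h; rewrite mulrC expRM_natr /log_bern lnK// posrE bern_mgf_gt0.
Qed.

Lemma geom_mgf_expR u k : p < u <= 1 -> geom_mgf u ^+ k = expR (- (k%:R * D u)).
Proof.
by move=> h; rewrite /geom_cost mulrN opprK mulrC expRM_natr lnK// posrE geom_mgf_gt0.
Qed.

Lemma ln_div_le (a b : R) : 0 < a -> 0 < b -> ln a - ln b <= (a - b) / b.
Proof.
move=> a0 b0; rewrite -ln_div ?posrE//.
rewrite (_ : a / b = 1 + (a - b) / b); last by field; rewrite gt_eqF.
apply: le_ln1Dx; rewrite ltr_pdivlMr//; lra.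
Qed.

(** One-sided bounds of this kind, which come from [ln z <= z - 1], replace
    derivatives below. *)
Lemma log_bern_sub_le u v : 0 <= u <= 1 -> 0 <= v <= 1 ->
  B v - B u <= (v - u) * ((x - 1) / bern_mgf u).
Proof.
move=> hu hv; apply: le_trans (ln_div_le (bern_mgf_gt0 hv) (bern_mgf_gt0 hu)) _.
by rewrite mulrA (_ : bern_mgf v - bern_mgf u = (v - u) * (x - 1))// /bern_mgf; ring.
Qed.

Lemma log_bern_lt u v : 0 <= u -> u < v -> v <= 1 -> B u < B v.
Proof.
move=> u0 uv v1; rewrite ltr_ln ?posrE ?bern_mgf_gt0//; try by apply/andP; split; lra.
rewrite -subr_gt0 /bern_mgf (_ : _ - _ = (v - u) * (x - 1)); last by ring.
by rewrite mulr_gt0 ?subr_gt0.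
Qed.

Lemma geom_costE u : p < u <= 1 -> D u = ln (u * A - p) - ln (u - p) - ln x.
Proof.
move=> pu1; rewrite /geom_cost geom_mgfE//; case/andP: pu1 => pu u1.
have h := geom_num_gt0 pu; have h' : 0 < u - p by rewrite subr_gt0.
by rewrite ln_div ?posrE ?mulr_gt0// lnM ?posrE//; ring.
Qed.

Lemma geom_cost_sub_le u v : p < u <= 1 -> p < v <= 1 ->
  D v - D u <= (v - u) * (A / (u * A - p) - (v - p)^-1).
Proof.
move=> hu hv; rewrite !geom_costE//; case/andP: hu => pu u1; case/andP: hv => pv v1.
have h1 := ln_div_le (geom_num_gt0 pv) (geom_num_gt0 pu).
have up : 0 < u - p by rewrite subr_gt0.
have vp : 0 < v - p by rewrite subr_gt0.
have h2 := ln_div_le up vp.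
apply: le_trans (_ : _ <= (v * A - p - (u * A - p)) / (u * A - p) + (u - p - (v - p)) / (v - p)) _.
  by lra.
rewrite le_eqVlt; apply/orP; left; apply/eqP; field.
by rewrite gt_eqF//= gt_eqF ?geom_num_gt0.
Qed.

Lemma geom_cost_mono u v : p < v -> v <= u -> u <= 1 -> D u <= D v.
Proof.
move=> pv vu u1; have pu := lt_le_trans pv vu.
have hu : p < u <= 1 by rewrite pu.
have hv : p < v <= 1 by rewrite pv (le_trans vu).
rewrite lerN2 ler_ln ?posrE ?geom_mgf_gt0// !geom_mgfE//.
rewrite ler_pdivrMr ?geom_num_gt0// mulrAC ler_pdivlMr ?geom_num_gt0// -subr_ge0.
rewrite (_ : _ - _ = x * p * (u - v) * (A - 1)); last by ring.
by rewrite !mulr_ge0 ?subr_ge0 ?(ltW x0) ?(ltW p0) ?(ltW A1).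
Qed.

(** The derivative in [u] of [s * log_bern u + t * geom_cost u] vanishes, with
    denominators cleared; see [tangentE]. *)
Definition tangent s t u : Prop :=
  t * (p * (1 - p) * bern_mgf u) = s * ((u * A - p) * (u - p)).

Let slope u : R := (x - 1) / bern_mgf u.

Lemma tangentE s t u : p < u < 1 -> tangent s t u ->
  s * slope u + t * (A / (u * A - p) - (u - p)^-1) = 0.
Proof.
move=> /andP[pu u1] h.
have hn := geom_num_gt0 pu; have up : 0 < u - p by rewrite subr_gt0.
have hb : 0 < bern_mgf u by apply: bern_mgf_gt0; rewrite (ltW u1) ltW// (lt_trans p0).
have -> : A / (u * A - p) - (u - p)^-1 =
    - (p * (1 - p) * (x - 1)) / ((u * A - p) * (u - p)).
  by rewrite /A; field; rewrite -/A !gt_eqF.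
apply: (mulIf (_ : bern_mgf u * ((u * A - p) * (u - p)) != 0)).
  by rewrite !mulf_neq0// gt_eqF.
rewrite mul0r /slope.
have -> : (s * ((x - 1) / bern_mgf u) + t * (- (p * (1 - p) * (x - 1)) / ((u * A - p) * (u - p)))) *
   (bern_mgf u * ((u * A - p) * (u - p))) =
   (x - 1) * (s * ((u * A - p) * (u - p)) - t * (p * (1 - p) * bern_mgf u)).
  by field; rewrite !gt_eqF.
by rewrite h subrr mulr0.
Qed.

Lemma slope_gt0 u : 0 <= u <= 1 -> 0 < slope u.
Proof. by move=> hu; rewrite divr_gt0 ?subr_gt0// bern_mgf_gt0. Qed.

(** If [u] is stationary for the direction [(s, t)], it is not stationary for
    [(s - e, t)]: a slightly larger parameter gives a smaller exponent. *)
Lemma perturb_right s t u e : p < u < 1 -> tangent s t u -> 0 < t -> 0 < e -> e <= s ->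
  exists2 v, u < v <= 1 & (s - e) * (B v - B u) + t * (D v - D u) < 0.
Proof.
move=> pu1 tg t0 e0 es; have tgE := tangentE pu1 tg; move: pu1 => /andP[pu u1].
have up : 0 < u - p by rewrite subr_gt0.
have hu : p < u <= 1 by rewrite pu ltW.
have hu01 := param_bounds hu; have sl := slope_gt0 hu01.
pose h := Num.min (1 - u) (e * slope u * (u - p) ^+ 2 / (2 * t)).
have h0 : 0 < h.
  by rewrite lt_min subr_gt0 u1 /=; apply: divr_gt0; [apply: mulr_gt0; [exact: mulr_gt0|exact: exprn_gt0]|exact: mulr_gt0].
have h1 : h <= 1 - u by rewrite ge_min lexx.
have h2 : h <= e * slope u * (u - p) ^+ 2 / (2 * t) by rewrite ge_min lexx orbT.
exists (u + h); first by lra.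
have hv : p < u + h <= 1 by apply/andP; split; lra.
have bB := log_bern_sub_le hu01 (param_bounds hv); have bD := geom_cost_sub_le hu hv.
have inv : (u - p)^-1 - (u + h - p)^-1 <= h / (u - p) ^+ 2.
  have hp : 0 < u + h - p by lra.
  rewrite (_ : _ - _ = h / (u - p) * (u + h - p)^-1); last first.
    by field; rewrite !gt_eqF.
  rewrite expr2 invfM mulrA; apply: ler_wpM2l; first by rewrite divr_ge0 ?ltW.
  by rewrite lef_pV2 ?posrE//; lra.
have key : t * (h / (u - p) ^+ 2) <= e * slope u / 2.
  have := h2; rewrite ler_pdivlMr ?mulr_gt0// => h3.
  rewrite mulrA ler_pdivrMr ?exprn_gt0//; lra.
have se : 0 <= s - e by lra.
have h3 : (s - e) * (B (u + h) - B u) <= (s - e) * (h * slope u).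
  by rewrite ler_wpM2l//; move: bB; rewrite /slope (_ : u + h - u = h)//; ring.
have h4 : t * (D (u + h) - D u) <= t * (h * (A / (u * A - p) - (u + h - p)^-1)).
  by rewrite ler_wpM2l ?(ltW t0)//; move: bD; rewrite (_ : u + h - u = h)//; ring.
apply: le_lt_trans (lerD h3 h4) _.
rewrite (_ : _ + _ = h * ((s * slope u + t * (A / (u * A - p) - (u - p)^-1)) -
   e * slope u + t * ((u - p)^-1 - (u + h - p)^-1))); last by ring.
rewrite tgE pmulr_rlt0//.
have h5 : t * ((u - p)^-1 - (u + h - p)^-1) <= t * (h / (u - p) ^+ 2).
  by rewrite ler_wpM2l ?(ltW t0).
have h6 : 0 < e * slope u by rewrite mulr_gt0.
lra.
Qed.

(** The mirror image of [perturb_right]: for the direction [(s, t - e)] a slightly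
    smaller parameter does better. *)
Lemma perturb_left s t u e : p < u < 1 -> tangent s t u -> 0 < s -> 0 < t ->
  0 < e -> e <= t ->
  exists2 v, p < v < u & s * (B v - B u) + (t - e) * (D v - D u) < 0.
Proof.
move=> pu1 tg s0 t0 e0 et; have tgE := tangentE pu1 tg; move: pu1 => /andP[pu u1].
have up : 0 < u - p by rewrite subr_gt0.
have hu : p < u <= 1 by rewrite pu ltW.
have hu01 := param_bounds hu; have sl := slope_gt0 hu01.
pose c := s * slope u / t.
have c0 : 0 < c by apply: divr_gt0 => //; apply: mulr_gt0.
have cE : A / (u * A - p) - (u - p)^-1 = - c.
  have tc : t * c = s * slope u by rewrite /c; field; rewrite gt_eqF.
  apply: (@mulfI _ t); first by rewrite gt_eqF.
  by rewrite mulrN tc; lra.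
pose h := Num.min ((u - p) / 2) (e * c * (u - p) ^+ 2 / (4 * t)).
have h0 : 0 < h.
  rewrite lt_min; apply/andP; split; first exact: divr_gt0.
  by apply: divr_gt0; [apply: mulr_gt0; [exact: mulr_gt0|exact: exprn_gt0]|exact: mulr_gt0].
have h1 : h <= (u - p) / 2 by rewrite ge_min lexx.
have h2 : h <= e * c * (u - p) ^+ 2 / (4 * t) by rewrite ge_min lexx orbT.
exists (u - h); first by apply/andP; split; lra.
have hv : p < u - h <= 1 by apply/andP; split; lra.
have bB := log_bern_sub_le hu01 (param_bounds hv); have bD := geom_cost_sub_le hu hv.
have inv : (u - h - p)^-1 - (u - p)^-1 <= 2 * (h / (u - p) ^+ 2).
  have hp : 0 < u - h - p by lra.
  rewrite (_ : _ - _ = h / (u - p) * (u - h - p)^-1); last first.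
    by field; rewrite !gt_eqF.
  have hinv : (u - h - p)^-1 <= ((u - p) / 2)^-1.
    by rewrite lef_pV2 ?posrE ?divr_gt0//; lra.
  apply: le_trans (_ : _ <= h / (u - p) * ((u - p) / 2)^-1) _.
    by apply: ler_wpM2l => //; apply: divr_ge0; apply: ltW.
  by rewrite le_eqVlt; apply/orP; left; apply/eqP; field; rewrite gt_eqF.
have key : t * (2 * (h / (u - p) ^+ 2)) <= e * c / 2.
  have := h2; rewrite ler_pdivlMr ?mulr_gt0// => h3.
  rewrite mulrA mulrA ler_pdivrMr ?exprn_gt0//; lra.
have te : 0 <= t - e by lra.
have h3 : s * (B (u - h) - B u) <= s * (- h * slope u).
  by rewrite ler_wpM2l ?(ltW s0)//; move: bB; rewrite /slope (_ : u - h - u = - h)//; ring.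
have h4 : (t - e) * (D (u - h) - D u) <=
    (t - e) * (- h * (A / (u * A - p) - (u - h - p)^-1)).
  by rewrite ler_wpM2l//; move: bD; rewrite (_ : u - h - u = - h)//; ring.
apply: le_lt_trans (lerD h3 h4) _.
rewrite (_ : _ + _ = - h * ((s * slope u + t * (A / (u * A - p) - (u - p)^-1)) -
   e * (A / (u * A - p) - (u - p)^-1) - (t - e) * ((u - h - p)^-1 - (u - p)^-1))); last by ring.
rewrite tgE cE nmulr_rlt0 ?oppr_lt0//.
have h5 : (t - e) * ((u - h - p)^-1 - (u - p)^-1) <= (t - e) * (2 * (h / (u - p) ^+ 2)).
  by rewrite ler_wpM2l.
have h6 : (t - e) * (2 * (h / (u - p) ^+ 2)) <= t * (2 * (h / (u - p) ^+ 2)).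
  rewrite ler_wpM2r//; last by lra.
  by rewrite mulr_ge0// divr_ge0 ?(ltW h0)// exprn_ge0// ltW.
have h7 : 0 < e * c by rewrite mulr_gt0.
lra.
Qed.

End Exponents.

(** * Growth of the moment generating function *)

Lemma square_lt_expR {R : realType} (C gamma : R) : 0 < gamma ->
  exists2 N, (0 < N)%N & C * N%:R ^+ 2 * expR (- (N%:R * gamma)) < 1.
Proof.
move=> g0; pose k := Num.truncn (6 * `|C| / gamma ^+ 3).
exists k.+1 => //; set N : R := k.+1%:R.
have N0 : 0 < N by rewrite ltr0n.
have hN : 6 * `|C| < N * gamma ^+ 3.
  by rewrite -ltr_pdivrMr ?exprn_gt0//; apply: truncnS_gt.
rewrite expRN mulrC -(ltr_pM2l (expR_gt0 (N * gamma))) mulVKf ?gt_eqF ?expR_gt0// mulr1.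
have := @expR_ge1Dxn R (N * gamma) 2 (mulr_ge0 (ltW N0) (ltW g0)).
apply: lt_le_trans; apply: (@lt_trans _ _ ((N * gamma) ^+ 3 / 3`!%:R)); last by rewrite ltrDr.
rewrite (_ : 3`! = 6)%N// ltr_pdivlMr//.
have : C * N ^+ 2 <= `|C| * N ^+ 2 by rewrite ler_wpM2r ?ler_norm// exprn_ge0// ltW.
have : 6 * `|C| * N ^+ 2 < N * gamma ^+ 3 * N ^+ 2 by rewrite ltr_pM2r// exprn_gt0.
rewrite exprMn (_ : N * gamma ^+ 3 * N ^+ 2 = N ^+ 3 * gamma ^+ 3); last by ring.
lra.
Qed.

Section LowerBound.
Context {R : realType} (p x : R).
Hypotheses (p01 : 0 < p < 1) (x1 : 1 < x).
Notation B := (log_bern x).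
Notation D := (geom_cost p x).

Lemma mgf_le_exp u m n : p < u <= 1 -> mgf p x m n <= expR (m%:R * B u + n.+1%:R * D u).
Proof.
move=> pu1; have := mgf_le_stationary p01 (ltW x1) pu1 (qparam_bounds p01 pu1)
  (qparamE p01 pu1) m n.
rewrite -/(geom_mgf p x u) -/(bern_mgf x u) geom_mgf_expR// bern_mgf_expR ?(param_bounds p01)//.
by rewrite -ler_pdivlMr ?expR_gt0// -expRN opprK -expRD.
Qed.

Lemma exp_le_mgf u m n : p < u <= 1 -> expR (m%:R * B u) <=
  \sum_(k < m.+1) expR (k%:R * B u - n.+1%:R * D u) * mgf p x (m - k) n +
  \sum_(l < n.+1) expR (- ((n - l)%:R * D u)) * mgf p x m (n - l).
Proof.
move=> pu1; have := stationary_le_mgf p01 (ltW x1) pu1 (qparam_bounds p01 pu1)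
  (qparamE p01 pu1) m n.
rewrite -/(geom_mgf p x u) -/(bern_mgf x u) bern_mgf_expR ?(param_bounds p01)//.
move/le_trans; apply; apply: lerD; apply: ler_sum => k _.
  by rewrite geom_mgf_expR// bern_mgf_expR ?(param_bounds p01)// -expRD addrC.
by rewrite geom_mgf_expR.
Qed.

(** In the direction for which [u] is stationary, the growth rate [M] of the
    generating function is at least [s * B u + t * D u].

    Otherwise choose [e] so small that moving the exit point by [e * N] changes
    the exponent by at most half of the deficit.  In [exp_le_mgf] the exits
    within [e * N] of the corner are then exponentially smaller than the left
    side, by the growth hypothesis.  For the exits beyond [e * N], bound the
    generating function by [mgf_le_exp] with the better parameter [v] or [w] of
    [perturb_right] or [perturb_left]; these terms are exponentially smaller as
    well.  Polynomially many such terms cannot add up to the left side. *)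
Lemma tangent_lower_bound s t u M : 0 < s -> 0 < t -> p < u < 1 ->
  tangent p x s t u ->
  (forall N, (0 < N)%N ->
     mgf p x (Num.truncn (N%:R * s)) (Num.truncn (N%:R * t)) <=
     (Num.truncn (N%:R * s)).+1%:R * expR (N%:R * M)) ->
  s * B u + t * D u <= M.
Proof.
move=> s0 t0 pu1 tg hZ; rewrite leNgt; apply/negP => Mlt.
have [pu u1] := andP pu1.
have hu : p < u <= 1 by rewrite pu ltW.
have [u_ge0 _] := andP (param_bounds p01 hu).
have B0 : 0 <= B u by apply: log_bern_ge0; rewrite ?(param_bounds p01).
have D0 : 0 <= D u by apply: geom_cost_ge0.
pose eta := (s * B u + t * D u - M) / 2.
have eta0 : 0 < eta by rewrite divr_gt0// subr_gt0.
pose e := Num.min (Num.min s t) (eta / (B u + D u + 1)).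
have BD1 : 0 < B u + D u + 1 by lra.
have e0 : 0 < e by rewrite !lt_min s0 t0 divr_gt0.
have es : e <= s by rewrite !ge_min lexx.
have et : e <= t by rewrite !ge_min lexx orbT.
have eE : e * (B u + D u + 1) <= eta.
  by rewrite -ler_pdivlMr// ge_min lexx orbT.
have eB : e * B u <= eta.
  by apply: le_trans eE; rewrite ler_wpM2l ?(ltW e0)//; lra.
have eD : e * D u <= eta.
  by apply: le_trans eE; rewrite ler_wpM2l ?(ltW e0)//; lra.
have [v /andP[uv v1] hv] := perturb_right p01 x1 pu1 tg t0 e0 es.
have [w /andP[pw wu] hw] := perturb_left p01 x1 pu1 tg s0 t0 e0 et.
have hv1 : p < v <= 1 by rewrite v1 (lt_trans pu).
have hw1 : p < w <= 1 by rewrite pw ltW// (lt_trans wu).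
have Bv : B u < B v by apply: log_bern_lt.
have Bw : B w < B u.
  by apply: log_bern_lt => //; [rewrite ltW// (lt_trans _ pw)//; case/andP: p01|exact: ltW].
have Dw : D u <= D w by apply: geom_cost_mono => //; exact: ltW.
have Dv : D v < D u.
  have : 0 <= (s - e) * (B v - B u) by rewrite mulr_ge0// subr_ge0// ltW.
  move=> h; have : t * (D v - D u) < 0 by lra.
  by rewrite pmulr_rlt0// subr_lt0.
have Dw0 : 0 <= D w by apply: geom_cost_ge0.
set g1 := (s - e) * (B v - B u) + t * (D v - D u) in hv.
set g2 := s * (B w - B u) + (t - e) * (D w - D u) in hw.
pose gamma := Num.min eta (Num.min (- g1) (- g2)).
have gamma0 : 0 < gamma by rewrite !lt_min eta0 !oppr_gt0 hv hw.
have ga_eta : gamma <= eta by rewrite !ge_min lexx.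
have ga_1 : gamma <= - g1 by rewrite !ge_min lexx orbT.
have ga_2 : gamma <= - g2 by rewrite !ge_min lexx !orbT.
pose kappa := B u + D u + D w + (B u - B w).
have [N N0 hN] := square_lt_expR ((s + t + 2) * (s + 1) * expR kappa) gamma0.
have NR : 1 <= N%:R :> R by rewrite ler1n.
have N0' : 0 <= N%:R :> R by [].
move: hN; apply/negP; rewrite -leNgt.
set m := Num.truncn (N%:R * s) in hZ *; set n := Num.truncn (N%:R * t) in hZ *.
have mle : m%:R <= N%:R * s by rewrite truncn_le mulr_ge0// ltW.
have nle : n%:R <= N%:R * t by rewrite truncn_le mulr_ge0// ltW.
have mgt : N%:R * s < m%:R + 1 by rewrite natr1; apply: truncnS_gt.
have ngt : N%:R * t < n%:R + 1 by rewrite natr1; apply: truncnS_gt.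
have {}hZ := hZ _ N0; rewrite -/m -/n in hZ.
(* [bnd] dominates every exit term; [kappa] absorbs the rounding of [N * s] and [N * t] *)
pose bnd := expR (m%:R * B u) * (m.+1%:R * expR (kappa - N%:R * gamma)).
have bndI z : z <= m%:R * B u + kappa - N%:R * gamma ->
    expR z * m.+1%:R <= bnd.
  by move=> hz; rewrite /bnd mulrCA mulrC -expRD ler_wpM2l// ler_expR; lra.
have bndI' z : z <= m%:R * B u + kappa - N%:R * gamma -> expR z <= bnd.
  move=> hz; apply: le_trans (bndI _ hz).
  by rewrite ler_peMr ?expR_ge0// ler1n.
have N_ga_eta : N%:R * gamma <= N%:R * eta by rewrite ler_wpM2l.
have N_ga_1 : N%:R * gamma <= N%:R * - g1 by rewrite ler_wpM2l.
have N_ga_2 : N%:R * gamma <= N%:R * - g2 by rewrite ler_wpM2l.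
have N_eB : N%:R * (e * B u) <= N%:R * eta by rewrite ler_wpM2l.
have N_eD : N%:R * (e * D u) <= N%:R * eta by rewrite ler_wpM2l.
have N_eta : N%:R * eta * 2 = N%:R * (s * B u) + N%:R * (t * D u) - N%:R * M.
  by rewrite /eta; field.
have mB : N%:R * (s * B u) - B u <= m%:R * B u.
  rewrite mulrA -[X in _ - X]mul1r -mulrBl ler_wpM2r//; lra.
have nD : N%:R * (t * D u) <= n.+1%:R * D u.
  rewrite mulrA ler_wpM2r// -natr1; lra.
have T1 (k : 'I_m.+1) :
    expR (k%:R * B u - n.+1%:R * D u) * mgf p x (m - k) n <= bnd.
  have km : (k <= m)%N by rewrite -ltnS.
  case: (leP k%:R (N%:R * e)) => hk.
    apply: le_trans (_ : _ <= expR (k%:R * B u - n.+1%:R * D u) *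
        (m.+1%:R * expR (N%:R * M))) _.
      rewrite ler_wpM2l ?expR_ge0//; apply: le_trans hZ.
      by apply: mgf_le_cols => //; exact: ltW.
    rewrite mulrCA mulrC -expRD; apply: bndI.
    have : k%:R * B u <= N%:R * (e * B u) by rewrite mulrA ler_wpM2r.
    by rewrite /kappa; lra.
  apply: le_trans (ler_wpM2l (expR_ge0 _) (mgf_le_exp _ _ hv1)) _.
  rewrite -expRD; apply: bndI'.
  have : (m - k)%:R * (B v - B u) <= N%:R * ((s - e) * (B v - B u)).
    rewrite mulrA ler_wpM2r ?subr_ge0 ?(ltW Bv)// natrB// mulrBr; lra.
  have : n.+1%:R * (D v - D u) <= N%:R * (t * (D v - D u)).
    rewrite mulrA ler_wnM2r ?subr_le0 ?(ltW Dv)// -natr1; lra.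
  move: N_ga_1; rewrite /g1 natrB// /kappa; lra.
have T2 (l : 'I_n.+1) : expR (- ((n - l)%:R * D u)) * mgf p x m (n - l) <= bnd.
  have ln : (l <= n)%N by rewrite -ltnS.
  case: (leP l%:R (N%:R * e)) => hl.
    apply: le_trans (_ : _ <= expR (- ((n - l)%:R * D u)) *
        (m.+1%:R * expR (N%:R * M))) _.
      rewrite ler_wpM2l ?expR_ge0//; apply: le_trans hZ.
      by apply: mgf_le_rows => //; exact: ltW.
    rewrite mulrCA mulrC -expRD; apply: bndI.
    have : l%:R * D u <= N%:R * (e * D u) by rewrite mulrA ler_wpM2r.
    by move: nD; rewrite natrB// -natr1 /kappa; lra.
  apply: le_trans (ler_wpM2l (expR_ge0 _) (mgf_le_exp _ _ hw1)) _.
  rewrite -expRD; apply: bndI'.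
  have : (n - l)%:R * (D w - D u) <= N%:R * ((t - e) * (D w - D u)).
    rewrite mulrA ler_wpM2r ?subr_ge0// natrB// mulrBr; lra.
  have : m%:R * (B w - B u) <= N%:R * (s * (B w - B u)) - (B w - B u).
    rewrite [leRHS](_ : _ = (N%:R * s - 1) * (B w - B u)); last by ring.
    by rewrite ler_wnM2r ?subr_le0 ?(ltW Bw)//; lra.
  move: N_ga_2; rewrite /g2 -[(n - l).+1%:R]natr1 /kappa; lra.
have := exp_le_mgf m n hu.
move/le_trans => /(_ _ (lerD (ler_sum _ (fun k _ => T1 k)) (ler_sum _ (fun l _ => T2 l)))).
rewrite !sumr_const !card_ord -mulrnDr -[bnd *+ _]mulr_natl /bnd mulrCA.
rewrite -[leLHS]mulr1 ler_pM2l ?expR_gt0// => /le_trans; apply.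
rewrite expRD mulrA mulrA mulrA ler_wpM2r ?expR_ge0//.
rewrite [leRHS]mulrAC ler_wpM2r ?expR_ge0//.
rewrite expr2 [leRHS]mulrA mulrAC -[leRHS]mulrA [leRHS]mulrAC mulrA.
rewrite [leRHS](_ : _ = ((s + t + 2) * N%:R) * ((s + 1) * N%:R)); last by ring.
apply: ler_pM => //.
  rewrite natrD -!natr1 !mulrDl; lra.
rewrite -natr1 mulrDl; lra.
Qed.

(** On the bottom row the last passage value is a sum of independent bits. *)
Lemma row0_lower_bound s M : 0 < s ->
  (forall N, (0 < N)%N ->
     mgf p x (Num.truncn (N%:R * s)) 0 <=
     (Num.truncn (N%:R * s)).+1%:R * expR (N%:R * M)) ->
  s * B p <= M.
Proof.
move=> s0 hZ; rewrite leNgt; apply/negP => Mlt.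
have [p0 p1] := andP p01.
have hp : 0 <= p <= 1 by rewrite !ltW.
have B0 := log_bern_ge0 x1 hp.
have g0 : 0 < s * B p - M by rewrite subr_gt0.
have [N N0 hN] := square_lt_expR ((s + 1) * expR (B p)) g0.
have NR : 1 <= N%:R :> R by rewrite ler1n.
have N0' : 0 <= N%:R :> R by [].
move: hN; apply/negP; rewrite -leNgt.
have := hZ _ N0; rewrite mgf_row0 -/(bern_mgf x p) bern_mgf_expR//.
set m := Num.truncn _.
have mle : m%:R <= N%:R * s by rewrite truncn_le mulr_ge0// ltW.
have mgt : N%:R * s < m%:R + 1 by rewrite natr1; apply: truncnS_gt.
have mB : N%:R * (s * B p) - B p <= m%:R * B p.
  rewrite mulrA -[X in _ - X]mul1r -mulrBl ler_wpM2r//; lra.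
rewrite -ler_pdivrMr ?expR_gt0// -expRN -expRD => h.
have : expR (N%:R * (s * B p - M) - B p) <= (s + 1) * N%:R ^+ 2.
  apply: le_trans (_ : _ <= m.+1%:R) _.
    by apply: le_trans h; rewrite ler_expR mulrBr; lra.
  have : N%:R <= N%:R ^+ 2 :> R by rewrite expr2 ler_peMl.
  have : N%:R * s <= N%:R ^+ 2 * s by rewrite ler_wpM2r ?(ltW s0)// expr2 ler_peMl.
  rewrite -natr1; lra.
rewrite expRD expRN ler_pdivrMr ?expR_gt0// => h2.
rewrite expRN ler_pdivlMr ?expR_gt0// mul1r; apply: le_trans h2 _.
by rewrite mulrAC.
Qed.

End LowerBound.

(** * The convex dual *)

Section DualFormula.
Context d (T : measurableType d) (R : realType) (P : probability T R) (p : R).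
Variable omega : site -> {RV P >-> bool}.
Hypothesis p01 : 0 < p < 1.
Hypothesis iid : iid_bernoulli p omega.
Variable xi : R.
Hypothesis xi0 : 0 < xi.

Let x : R := expR xi.
Let x1 : 1 < x. Proof. by rewrite /x -expR0 ltr_expR. Qed.
Implicit Types r s t u e M : R.
Notation B := (log_bern x).
Notation D := (geom_cost p x).

Lemma tail_prob_chernoff m n y :
  tail_prob p m n y <= expR (- (y * xi)) * mgf p x m n.
Proof.
have p01w : 0 <= p <= 1 by case/andP: p01 => ? ?; rewrite !ltW.
rewrite -ErowsZ; apply: Erows_le => // rs _ _.
case: (leP y) => [h|_]; last first.
  by apply: mulr_ge0; rewrite ?exprn_ge0// expR_ge0.
rewrite /x -expRM_natl -expRD -[leLHS]expR0 ler_expR.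
have : y * xi <= (lpp (config_of_rows rs) m n)%:R * xi by rewrite ler_wpM2r// ltW.
lra.
Qed.

(** The exponential Markov inequality combined with [mgf_le_exp]. *)
Lemma rate_ge_affine s t r u : 0 < s -> 0 < t -> r < s -> p < u <= 1 ->
  r * xi - (s * B u + t * D u) <= rate omega s t r.
Proof.
move=> s0 t0 rs hu; apply: (@rate_ge _ _ _ _ _ _ p01 iid _ _ _ s0 t0 rs _ (D u) 0%N) => N _.
apply: le_trans (tail_prob_chernoff _ _ _) _.
apply: le_trans (ler_wpM2l (expR_ge0 _) (mgf_le_exp p01 x1 _ _ hu)) _.
rewrite -expRD ler_expR.
have N0 : 0 <= N%:R :> R by [].
have hB : (Num.truncn (N%:R * s))%:R * B u <= N%:R * s * B u.
  by rewrite ler_wpM2r ?log_bern_ge0 ?(param_bounds p01)// truncn_le mulr_ge0// ltW.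
have hD : (Num.truncn (N%:R * t)).+1%:R * D u <= (N%:R * t + 1) * D u.
  by rewrite ler_wpM2r ?geom_cost_ge0// -natr1 lerD2r truncn_le mulr_ge0// ltW.
rewrite mulrBr !mulrDr; lra.
Qed.

(** At a boundary point, compare with interior points [(s, t + h, r - h)] and let
    [h] tend to zero. *)
Lemma dual_term_le s t r u : 0 <= s -> 0 <= t -> p < u <= 1 ->
  ((r * xi)%:E - J omega s t r <= (s * B u + t * D u)%:E)%E.
Proof.
move=> s0 t0 hu; have xi_gt0 := xi0.
case: (leP r s) => [rs|sr]; last by rewrite J_out//= leNye.
have D0 : 0 <= D u by apply: geom_cost_ge0.
have B0 : 0 <= B u by rewrite log_bern_ge0 ?(param_bounds p01).
case: (eqVneq s 0) => [s0'|sn0].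
  rewrite s0' in rs *; rewrite (J_left p01 iid)// sube0 lee_fin mul0r add0r.
  by apply: (@le_trans _ _ 0); [exact: mulr_le0_ge0 rs (ltW xi0)|exact: mulr_ge0].
have {sn0} s_gt0 : 0 < s by rewrite lt_neqAle eq_sym sn0.
have [j -> [hU _]] := J_bracket p01 iid s_gt0 t0 rs.
rewrite -EFinB lee_fin; apply/ler_addgt0Pr => e e0.
have K0 : 0 < xi + D u + 1 by lra.
pose h := e / (xi + D u + 1).
have h0 : 0 < h by rewrite divr_gt0.
have hE : h * (xi + D u) <= e.
  have : h * (xi + D u + 1) = e by rewrite /h divfK ?gt_eqF.
  lra.
have := hU (t + h) (r - h) _ _; rewrite ltrDl gtrBl h0 => /(_ isT isT).
have th : 0 < t + h by lra.
have rh : r - h < s by lra.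
have := rate_ge_affine s_gt0 th rh hu.
lra.
Qed.

(** A bound [M] on the dual bounds the growth of the generating function, because
    the tail probabilities are at most [expR (- N J)] for every [N], with no
    correction factor. *)
Lemma mgf_le_dual s t M : 0 < s -> 0 <= t ->
  (forall r, ((r * xi)%:E - J omega s t r <= M%:E)%E) ->
  forall N, (0 < N)%N -> mgf p x (Num.truncn (N%:R * s)) (Num.truncn (N%:R * t)) <=
    (Num.truncn (N%:R * s)).+1%:R * expR (N%:R * M).
Proof.
move=> s0 t0 hM N N0; have N0' : 0 < N%:R :> R by rewrite ltr0n.
apply: le_trans (mgf_le_sum_tail_prob p01 _ _ (ltW x1)) _.
set m := Num.truncn _.
have -> : m.+1%:R * expR (N%:R * M) = \sum_(k < m.+1) expR (N%:R * M).
  by rewrite sumr_const card_ord mulr_natl.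
apply: ler_sum => k _.
have km : k%:R <= N%:R * s.
  apply: (@le_trans _ _ m%:R); first by rewrite ler_nat -ltnS.
  by rewrite truncn_le mulr_ge0// ltW.
have rs : k%:R / N%:R <= s by rewrite ler_pdivrMr// mulrC.
have [j Jj [_ /(_ N) hL]] := J_bracket p01 iid s0 t0 rs.
have := hM (k%:R / N%:R); rewrite Jj -EFinB lee_fin => hj.
have : tail_prob p m (Num.truncn (N%:R * t)) k%:R <= expR (- (N%:R * j)).
  by apply: le_trans hL; rewrite /tail_seq [_ * (_ / _)]mulrC divfK ?gt_eqF.
move/(ler_wpM2l (exprn_ge0 k (ltW (lt_trans ltr01 x1)))) => /le_trans; apply.
rewrite /x -expRM_natl -expRD ler_expR.
have -> : k%:R * xi - N%:R * j = N%:R * (k%:R / N%:R * xi - j).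
  by field; rewrite gt_eqF.
by rewrite ler_wpM2l// ltW.
Qed.

Lemma log_bern1 : B 1 = xi.
Proof. by rewrite /log_bern /bern_mgf subrr add0r mul1r expRK. Qed.

(** A direction with [t / s < (1 - p) / p] is tangent for some [u] strictly between
    [p] and [1].  Beyond this slope the last passage value is flat, and [u = 1] is
    the limit of the parameters that are tangent for smaller [t]; for [t = 0] the
    infimum is approached as [u] tends to [p]. *)
Lemma dual_lower_bound s t M : 0 <= s -> 0 <= t -> 0 <= M ->
  (forall r, ((r * xi)%:E - J omega s t r <= M%:E)%E) ->
  forall e, 0 < e -> exists2 u, p < u <= 1 & s * B u + t * D u <= M + e.
Proof.
move=> s0 t0 M0 hM e e0; have [p0 p1] := andP p01.
have p1e : p < (1 : R) <= 1 by rewrite p1 lexx.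
case: (eqVneq s 0) => [->|sn0].
  by exists 1; rewrite // (geom_cost1 x p01) mul0r mulr0 addr0; lra.
have {sn0} s_gt0 : 0 < s by rewrite lt_neqAle eq_sym sn0.
have hZ := mgf_le_dual s_gt0 t0 hM.
case: (eqVneq t 0) => [t0'|tn0].
  (* no room above the bottom row: u tends to p *)
  rewrite t0' in hZ *.
  have hp : 0 <= p <= 1 by rewrite !ltW.
  have lb : s * B p <= M.
    by apply: (row0_lower_bound p01 x1 s_gt0) => N /hZ; rewrite mulr0 truncn0.
  pose c := s * ((x - 1) / bern_mgf x p).
  have c0 : 0 < c by rewrite mulr_gt0// divr_gt0 ?subr_gt0// bern_mgf_gt0.
  pose h := Num.min (1 - p) (e / c).
  have h0 : 0 < h by rewrite lt_min subr_gt0 p1 divr_gt0.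
  have h1 : h <= 1 - p by rewrite ge_min lexx.
  have h2 : h * c <= e by rewrite -ler_pdivlMr// ge_min lexx orbT.
  have hu : p < p + h <= 1 by apply/andP; split; lra.
  exists (p + h) => //; rewrite mul0r addr0.
  have := log_bern_sub_le x1 hp (param_bounds p01 hu).
  rewrite (_ : p + h - p = h); last by ring.
  move/(ler_wpM2l s0); rewrite mulrBr (_ : s * (h * _) = h * c); last by rewrite /c; ring.
  lra.
have {tn0} t_gt0 : 0 < t by rewrite lt_neqAle eq_sym tn0.
pose A := (1 - p) * x + p.
have bern_mgf_pos u : p < u < 1 -> 0 < bern_mgf x u.
  by move=> /andP[pu u1]; apply: bern_mgf_gt0; rewrite // (ltW u1) ltW// (lt_trans p0).
case: (ltP (t * p) (s * (1 - p))) => hst.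
  (* the tangency equation is a quadratic with a root between p and 1 *)
  pose Q : {poly R} := s *: ((A *: 'X - p%:P) * ('X - p%:P)) -
    (t * (p * (1 - p))) *: ((x - 1) *: 'X + 1%:P).
  have QE z : Q.[z] = s * ((z * A - p) * (z - p)) - t * (p * (1 - p) * bern_mgf x z).
    by rewrite /Q /bern_mgf !hornerE /=; ring.
  have Qp : Q.[p] < 0.
    rewrite QE subrr !mulr0 sub0r oppr_lt0; apply: mulr_gt0 => //.
    apply: mulr_gt0; first by apply: mulr_gt0; rewrite ?subr_gt0.
    by apply: bern_mgf_gt0; rewrite // !ltW.
  have Q1 : 0 < Q.[1].
    rewrite QE /bern_mgf /A [ltRHS](_ : _ = (1 - p) * x * (s * (1 - p) - t * p)); last by ring.
    apply: mulr_gt0; last by rewrite subr_gt0.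
    by apply: mulr_gt0; [rewrite subr_gt0|exact: lt_trans x1].
  have [u /andP[pu u1] /eqP Qu] : exists2 u, p <= u <= 1 & root Q u.
    by apply: poly_ivt; rewrite ?ltW// !ltW.
  have hu : p < u < 1.
    rewrite !lt_neqAle pu u1 !andbT; apply/andP; split; apply/eqP => E.
      by move: Qp; rewrite E Qu ltxx.
    by move: Q1; rewrite -E Qu ltxx.
  exists u; first by case/andP: hu => -> /ltW.
  have tg : tangent p x s t u.
    by rewrite /tangent; move: Qu; rewrite QE => /eqP; rewrite subr_eq0 => /eqP.
  have := tangent_lower_bound p01 x1 s_gt0 t_gt0 hu tg hZ; lra.
(* the flat part: u tends to 1 *)
exists 1 => //; rewrite (geom_cost1 x p01) mulr0 addr0 log_bern1.
suff lbu u : p < u < 1 -> s * B u <= M.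
  pose c := s * (x - 1) / bern_mgf x p.
  have bp : 0 < bern_mgf x p by apply: bern_mgf_gt0; rewrite // !ltW.
  have c0 : 0 < c by apply: divr_gt0 => //; rewrite mulr_gt0// subr_gt0.
  pose h := Num.min ((1 - p) / 2) (e / c).
  have h0 : 0 < h by rewrite lt_min; apply/andP; split; rewrite divr_gt0 ?subr_gt0.
  have h1 : h <= (1 - p) / 2 by rewrite ge_min lexx.
  have h2 : h * c <= e by rewrite -ler_pdivlMr// ge_min lexx orbT.
  have hu : p < 1 - h < 1 by apply/andP; split; lra.
  have hu01 : 0 <= 1 - h <= 1 by apply/andP; split; lra.
  have one01 : 0 <= (1 : R) <= 1 by rewrite ler01 lexx.
  have := log_bern_sub_le x1 hu01 one01; rewrite log_bern1 (_ : 1 - (1 - h) = h); last by ring.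
  move/(ler_wpM2l s0); have := lbu _ hu; rewrite mulrBr => hl hb.
  have : s * (h * ((x - 1) / bern_mgf x (1 - h))) <= h * c.
    rewrite mulrCA /c -mulrA ler_wpM2l ?(ltW h0)// ler_wpM2l//.
    rewrite ler_wpM2l ?subr_ge0 ?(ltW x1)// lef_pV2 ?posrE ?(bern_mgf_pos _ hu) ?bp//.
    rewrite /bern_mgf -subr_ge0 (_ : _ - _ = (1 - h - p) * (x - 1)); last by ring.
    by rewrite mulr_ge0 ?subr_ge0 ?(ltW x1)//; lra.
  lra.
move=> hu; have [pu u1] := andP hu; have bu := bern_mgf_pos _ hu.
have hu' : p < u <= 1 by rewrite pu ltW.
have up : 0 < u - p by rewrite subr_gt0.
have nu : 0 < u * A - p by apply: geom_num_gt0.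
have pp : 0 < p * (1 - p) by rewrite mulr_gt0// subr_gt0.
pose tu : R := s * ((u * A - p) * (u - p)) / (p * (1 - p) * bern_mgf x u).
have tu0 : 0 < tu.
  by apply: divr_gt0; [apply: mulr_gt0 => //|]; exact: mulr_gt0.
have tg : tangent p x s tu u by rewrite /tangent /tu divfK// gt_eqF// mulr_gt0.
have tut : tu <= t.
  rewrite /tu ler_pdivrMr; last exact: mulr_gt0.
  apply: (@le_trans _ _ (s * (((1 - p) * bern_mgf x u) * (1 - p)))).
    rewrite ler_wpM2l//; apply: ler_pM => //; [exact: ltW|exact: ltW| |lra].
    rewrite /bern_mgf /A -subr_ge0 (_ : _ - _ = 1 - u); last by ring.
    by rewrite subr_ge0 ltW.
  rewrite (_ : s * _ = (s * (1 - p)) * ((1 - p) * bern_mgf x u)); last by ring.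
  rewrite (_ : t * _ = (t * p) * ((1 - p) * bern_mgf x u)); last by ring.
  by rewrite ler_wpM2r// mulr_ge0 ?subr_ge0 ?(ltW p1) ?(ltW bu).
have : s * B u + tu * D u <= M.
  apply: (tangent_lower_bound p01 x1 s_gt0 tu0 hu tg) => N N0.
  apply: le_trans (hZ N N0).
  have le_truncn_tu : (Num.truncn (N%:R * tu) <= Num.truncn (N%:R * t))%N.
    by apply: le_truncn; rewrite ler_wpM2l.
  have := mgf_le_rows (n := Num.truncn (N%:R * t)) p01 (ltW x1)
    (Num.truncn (N%:R * s)) (leq_subr (Num.truncn (N%:R * tu)) _).
  by rewrite subKn.
have : 0 <= tu * D u by rewrite mulr_ge0 ?(ltW tu0)// geom_cost_ge0.
lra.
Qed.

Lemma C_geometricE u : p < u <= 1 ->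
  C_geometric ((u - p) / (u * (1 - p))) (- xi) = (- D u)%:E.
Proof.
move=> hu; have [q0 q1] := andP (qparam_bounds p01 hu).
rewrite /C_geometric -/(qparam p u) /geom_cost opprK /geom_mgf /x -expRN.
case: eqP => [->|/eqP qn1]; first by rewrite subrr mulr0 subr0 divr1 ln1.
have lt1 : 0 < 1 - qparam p u < 1.
  by rewrite gtrBl q0 subr_gt0 lt_neqAle qn1 q1.
rewrite ifT ?[expR _ * _]mulrC//; have := ln_lt0 lt1; have := xi0; lra.
Qed.

End DualFormula.

Unset Implicit Arguments.
Set Strict Implicit.

Theorem proposition4p1 (R : realType) (d : measure_display)
    (T : measurableType d) (P : probability T R) (p : R)
    (omega : site -> {RV P >-> bool}) (s t : R) :
  0 < p < 1 -> iid_bernoulli p omega -> 0 <= s -> 0 <= t ->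
  forall xi : R,
    convex_dual (J omega s t) xi =
    if 0 < xi then
      ereal_inf [set ((s * C_bernoulli u xi)%:E -
                      t%:E * C_geometric ((u - p) / (u * (1 - p))) (- xi))%E
                | u in [set u : R | p < u <= 1]]
    else if xi == 0 then 0%E
    else +oo%E.
Proof.
move=> p01 iid s0 t0 xi.
have dual_ge r : r <= 0 -> ((r * xi)%:E <= convex_dual (J omega s t) xi)%E.
  move=> r0; rewrite -[leLHS]sube0 -(J_npos p01 iid s0 t0 r0).
  by apply: ereal_sup_ubound; exists r.
case: ltP => [xi0|xi0]; last first.
  case: eqP => [xi0'|/eqP xin0].
    apply/eqP; rewrite eq_le; apply/andP; split; last first.
      by have := dual_ge 0 (lexx 0); rewrite mul0r.
    apply: ge_ereal_sup => _ [r _ <-].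
    by rewrite xi0' mulr0 sub0e leeNl oppe0; apply: (J_ge0 p01 iid).
  have xilt0 : xi < 0 by rewrite lt_neqAle xin0.
  apply: eq_infty => y; case: (leP y 0) => y0.
    by apply: le_trans (dual_ge 0 (lexx 0)); rewrite mul0r lee_fin.
  have := dual_ge (y / xi); rewrite divfK//; apply.
  by rewrite ltW// pmulr_rlt0// invr_lt0.
set I := ereal_inf _.
have valE u : p < u <= 1 -> ((s * C_bernoulli u xi)%:E -
    t%:E * C_geometric ((u - p) / (u * (1 - p))) (- xi))%E =
    (s * log_bern (expR xi) u + t * geom_cost p (expR xi) u)%:E.
  by move=> hu; rewrite (C_geometricE p01 xi0 hu) -EFinM -EFinB mulrN opprK.
apply/eqP; rewrite eq_le; apply/andP; split.
  apply: ge_ereal_sup => _ [r _ <-]; apply: le_ereal_inf_tmp => _ [u hu <-].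
  by rewrite valE//; apply: (dual_term_le p01 iid).
have hle r : ((r * xi)%:E - J omega s t r <= convex_dual (J omega s t) xi)%E.
  by apply: ereal_sup_ubound; exists r.
have := dual_ge 0 (lexx 0); rewrite mul0r.
move: hle; case: (convex_dual _ _) => [M|_ _|//]; last by rewrite leey.
move=> hM; rewrite lee_fin => M0.
apply/lee_addgt0Pr => e e0.
have [u hu hle] := dual_lower_bound p01 iid xi0 s0 t0 M0 hM e0.
apply: (@le_trans _ _ (s * log_bern (expR xi) u + t * geom_cost p (expR xi) u)%:E).
  by rewrite -valE//; apply: ereal_inf_lbound; exists u.
by rewrite -EFinD lee_fin.
Qed.
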